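(* Let $G$ be a simply connected five dimensional nilpotent Lie group with a left invariant Riemannian metric $\tilde a$, whose Lie algebra $\mathfrak l_{5,9}$ has an $\tilde a$-orthonormal basis $\{E_1,\dots,E_5\}$ with non-zero brackets $[E_1,E_2]=kE_3+lE_4+mE_5$, $[E_1,E_3]=pE_4$, $[E_2,E_3]=qE_5$, where either $k>0$, $q>p>0$ and $l,m\ge0$, or $k,p>0$, $l\ge0$, $m=0$ and $q=p$. Let $F$ be a left invariant non-Riemannian Randers metric of Douglas type on $G$, induced by $\tilde a$ and a left invariant vector field $X=\lambda_1E_1+\lambda_2E_2$. Then the $S$-curvature of $F$ is given by $$S(Y)=3\left\{\frac{(y_1\lambda_2-y_2\lambda_1)(ky_3+ly_4+my_5)-y_3(p\lambda_1y_4+q\lambda_2y_5)}{F(Y)}\right\},$$ where $Y=y_1E_1+y_2E_2+y_3E_3+y_4E_4+y_5E_5$ (non-zero).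
   Context: Brackets of basis elements not listed (and not obtained by antisymmetry) are zero. The Randers metric induced by $\tilde a$ and $X$, where $\sqrt{\tilde a(X,X)}<1$, is $F(x,y)=\sqrt{\tilde a(y,y)}+\tilde a(X(x),y)$. The spray coefficients of $F$ in standard local coordinates $(x,y)$ of the tangent bundle are $G^i=\frac14 g^{ij}\big([F^2]_{x^ry^j}y^r-[F^2]_{x^j}\big)$, where $g_{ij}=\frac12\frac{\partial^2F^2}{\partial y^i\partial y^j}$. $F$ is of Douglas type if in every standard local coordinate system $G^i=\frac12\Gamma^i_{jr}(x)y^jy^r+P(x,y)y^i$ for some functions $\Gamma^i_{jr}(x)$ and some local function $P(x,y)$ positively homogeneous of degree one in $y$. The $S$-curvature (Shen), with respect to the Busemann–Hausdorff volume form $\sigma(x)\,dx^1\cdots dx^n$, $\sigma(x)=\mathrm{Vol}(\text{unit ball of }\mathbb R^n)/\mathrm{Vol}\{(y^i)\in\mathbb R^n: F(x,y^i\partial_{x^i})<1\}$, is $S(x,y)=\frac{\partial G^r}{\partial y^r}(x,y)-y^r\frac{\partial\ln\sigma}{\partial x^r}(x)$; $S(Y)$ denotes $S(e,Y)$ and $F(Y)$ denotes $F(e,Y)$ for $Y$ in the Lie algebra $T_eG$. *)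

(* Defs.v *)
From HB Require Import structures.
From mathcomp Require Import all_boot all_order all_algebra.
From mathcomp Require Import all_classical all_reals all_analysis.

Set Implicit Arguments.
Unset Strict Implicit.
Unset Printing Implicit Defensive.

Import Order.TTheory GRing.Theory Num.Theory.
Import numFieldNormedType.Exports.

Local Open Scope classical_set_scope.
Local Open Scope ring_scope.

(* On an open set [U] of a finite dimensional space this is [C^k]. *)
Fixpoint Ck_on (R : realType) (V W : normedModType R) (k : nat)
    (U : set V) (f : V -> W) : Prop :=
  match k with
  | 0 => forall x, U x -> {for x, continuous f}
  | k'.+1 => (forall x, U x -> differentiable f x) /\
             (forall v, Ck_on k' U ('D_v f))
  end.

Definition smooth_on (R : realType) (V W : normedModType R)
  (U : set V) (f : V -> W) : Prop := forall k, Ck_on k U f.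

(* [chart_inv] is only meaningful on [chart_codom]. *)
Record chart (R : realType) (n : nat) (T : topologicalType) := Chart {
  chart_map :> T -> 'rV[R]_n;
  chart_inv : 'rV[R]_n -> T;
  chart_dom : set T;
  chart_dom_open : open chart_dom;
  chart_codom_open : open (chart_map @` chart_dom);
  chart_mapK : forall p, chart_dom p -> chart_inv (chart_map p) = p;
  chart_map_continuous : {within chart_dom, continuous chart_map};
  chart_inv_continuous :
    {within chart_map @` chart_dom, continuous chart_inv} }.

Definition chart_codom (R : realType) (n : nat) (T : topologicalType)
  (c : chart R n T) : set 'rV[R]_n := c @` chart_dom c.

Definition local_rep (R : realType) (n : nat) (T : topologicalType)
  (c c' : chart R n T) (f : T -> T) : 'rV[R]_n -> 'rV[R]_n :=
  c' \o f \o chart_inv c.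

Definition local_dom (R : realType) (n : nat) (T : topologicalType)
  (c c' : chart R n T) (f : T -> T) : set 'rV[R]_n :=
  [set x | chart_codom c x /\ chart_dom c' (f (chart_inv c x))].

(* A smooth structure is a maximal smooth atlas, so that [atlas] is the
   collection of all standard local coordinate systems. *)
HB.mixin Record isManifold (R : realType) (n : nat) T of Topological T := {
  atlas : set (chart R n T);
  atlas_cover : forall p : T, exists2 c, atlas c & chart_dom c p;
  atlas_compat : forall c c', atlas c -> atlas c' ->
    smooth_on (local_dom c c' id) (local_rep c c' id);
  atlas_maximal : forall c : chart R n T,
    (forall c', atlas c' ->
       smooth_on (local_dom c c' id) (local_rep c c' id) /\
       smooth_on (local_dom c' c id) (local_rep c' c id)) -> atlas c;
  manifold_hausdorff : hausdorff_space T;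
  manifold_second_countable : @second_countable T }.

#[short(type="manifoldType")]
HB.structure Definition Manifold (R : realType) (n : nat) :=
  {T of isManifold R n T & Topological T}.

HB.mixin Record isLieGroup (R : realType) (n : nat) G
    of Manifold R n G & Group G := {
  lie_mul_continuous : continuous (fun z : G * G => (z.1 * z.2)%g);
  lie_inv_continuous : continuous (fun g : G => (g^-1)%g);
  lie_mul_smooth : forall c1 c2 c3 : chart R n G,
    atlas c1 -> atlas c2 -> atlas c3 ->
    smooth_on
      [set z : 'rV[R]_n * 'rV[R]_n | [/\ chart_codom c1 z.1, chart_codom c2 z.2
         & chart_dom c3 (chart_inv c1 z.1 * chart_inv c2 z.2)%g]]
      (fun z => c3 (chart_inv c1 z.1 * chart_inv c2 z.2)%g);
  lie_inv_smooth : forall c c' : chart R n G, atlas c -> atlas c' ->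
    smooth_on (local_dom c c' (fun g => (g^-1)%g))
              (local_rep c c' (fun g => (g^-1)%g)) }.

#[short(type="lieGroupType")]
HB.structure Definition LieGroup (R : realType) (n : nat) :=
  {G of isLieGroup R n G & Manifold R n G & Group G}.

Definition simply_connected (R : realType) (T : topologicalType) : Prop :=
  (forall p q : T, exists f : R -> T,
     [/\ {within `[0, 1], continuous f}, f 0 = p & f 1 = q]) /\
  (forall f : R -> T, {within `[0, 1], continuous f} -> f 0 = f 1 ->
     exists H : R * R -> T,
       [/\ {within `[0, 1]%classic `*` `[0, 1]%classic, continuous H},
           forall t, 0 <= t <= 1 -> H (0, t) = f t /\ H (1, t) = f 0
         & forall s, 0 <= s <= 1 -> H (s, 0) = f 0 /\ H (s, 1) = f 0]).

Definition is_subgroup (G : groupType) (H : set G) : Prop :=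
  group_closed (mem H).

Fixpoint lower_central (G : groupType) (n : nat) : set G :=
  match n with
  | 0 => setT
  | n'.+1 => smallest (@is_subgroup G)
      [set z | exists x y, lower_central n' x /\ z = [~ x, y]%g]
  end.

Definition nilpotent_group (G : groupType) : Prop :=
  exists n, @lower_central G n = [set 1%g].

(* A tensor field is given by its components in every chart, as a function of
   the coordinates [x] of the base point. For a vector field [X], [X c x] is
   the row of components with respect to the coordinate frame of [c]; for a
   metric [a], [a c x] is the Gram matrix of that frame. The values at charts
   outside [atlas] and at [x] outside [chart_codom c] are irrelevant. *)
Definition vfield (R : realType) (n : nat) (G : topologicalType) :=
  chart R n G -> 'rV[R]_n -> 'rV[R]_n.

Definition bilfield (R : realType) (n : nat) (G : topologicalType) :=
  chart R n G -> 'rV[R]_n -> 'M[R]_n.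

(* Functions on the tangent bundle, in standard coordinates [(x, y)]. *)
Definition finsler (R : realType) (n : nat) (G : topologicalType) :=
  chart R n G -> 'rV[R]_n -> 'rV[R]_n -> R.

Definition vfield_eq (R : realType) (n : nat) (G : manifoldType R n)
    (X Y : vfield R n G) : Prop :=
  forall c : chart R n G, atlas c -> forall x, chart_codom c x ->
  X c x = Y c x.

Definition vf_invariant_by (R : realType) (n : nat) (G : manifoldType R n)
    (f : G -> G) (X : vfield R n G) : Prop :=
  forall c c' : chart R n G, atlas c -> atlas c' ->
  forall x, local_dom c c' f x ->
  X c' (local_rep c c' f x) = 'd (local_rep c c' f) x (X c x).

(* Invariance by [id] is the transformation rule under change of charts. *)
Definition vector_field (R : realType) (n : nat) (G : manifoldType R n)
    (X : vfield R n G) : Prop :=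
  (forall c : chart R n G, atlas c -> smooth_on (chart_codom c) (X c)) /\
  vf_invariant_by id X.

Definition left_invariant_vector_field (R : realType) (n : nat)
    (G : lieGroupType R n) (X : vfield R n G) : Prop :=
  vector_field X /\ forall g : G, vf_invariant_by (fun h => (g * h)%g) X.

Definition lie_bracket (R : realType) (n : nat) (G : topologicalType)
    (X Y : vfield R n G) : vfield R n G :=
  fun c x => 'D_(X c x) (Y c) x - 'D_(Y c x) (X c) x.

Definition bil (R : realType) (n : nat) (A : 'M[R]_n) (u v : 'rV[R]_n) : R :=
  (u *m A *m v^T) 0 0.

Definition bil_invariant_by (R : realType) (n : nat) (G : manifoldType R n)
    (f : G -> G) (a : bilfield R n G) : Prop :=
  forall c c' : chart R n G, atlas c -> atlas c' ->
  forall x, local_dom c c' f x -> forall u v,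
  bil (a c' (local_rep c c' f x))
      ('d (local_rep c c' f) x u) ('d (local_rep c c' f) x v) =
  bil (a c x) u v.

Definition riemannian_metric (R : realType) (n : nat) (G : manifoldType R n)
    (a : bilfield R n G) : Prop :=
  [/\ forall c : chart R n G, atlas c -> smooth_on (chart_codom c) (a c),
      forall c : chart R n G, atlas c -> forall x, chart_codom c x ->
        (a c x)^T = a c x /\ forall u, u != 0 -> 0 < bil (a c x) u u
    & bil_invariant_by id a].

Definition left_invariant_metric (R : realType) (n : nat)
    (G : lieGroupType R n) (a : bilfield R n G) : Prop :=
  riemannian_metric a /\
  forall g : G, bil_invariant_by (fun h => (g * h)%g) a.

Definition orthonormal_frame (R : realType) (n : nat) (G : manifoldType R n)
    (a : bilfield R n G) (E : 'I_n -> vfield R n G) : Prop :=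
  forall c : chart R n G, atlas c -> forall x, chart_codom c x ->
  forall i j, bil (a c x) (E i c x) (E j c x) = (i == j)%:R.

Definition randers (R : realType) (n : nat) (G : topologicalType)
    (a : bilfield R n G) (X : vfield R n G) : finsler R n G :=
  fun c x y => Num.sqrt (bil (a c x) y y) + bil (a c x) (X c x) y.

Definition norm_lt1 (R : realType) (n : nat) (G : manifoldType R n)
    (a : bilfield R n G) (X : vfield R n G) : Prop :=
  forall c : chart R n G, atlas c -> forall x, chart_codom c x ->
  Num.sqrt (bil (a c x) (X c x) (X c x)) < 1.

Definition left_invariant_finsler (R : realType) (n : nat)
    (G : lieGroupType R n) (F : finsler R n G) : Prop :=
  forall (g : G) (c c' : chart R n G), atlas c -> atlas c' ->
  forall x, local_dom c c' (fun h => (g * h)%g) x -> forall y,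
  let f := local_rep c c' (fun h => (g * h)%g) in
  F c' (f x) ('d f x y) = F c x y.

Definition riemannian_finsler (R : realType) (n : nat) (G : manifoldType R n)
    (F : finsler R n G) : Prop :=
  exists2 h : bilfield R n G, riemannian_metric h &
  forall c : chart R n G, atlas c -> forall x, chart_codom c x -> forall y,
  F c x y = Num.sqrt (bil (h c x) y y).

Definition partial (R : realType) (n : nat) (i : 'I_n)
  (f : 'rV[R]_n -> R) : 'rV[R]_n -> R := 'D_(delta_mx 0 i) f.

Section LocalFinsler.
Variables (R : realType) (n : nat) (F : 'rV[R]_n -> 'rV[R]_n -> R).

Definition fundamental_tensor (x y : 'rV[R]_n) : 'M[R]_n :=
  \matrix_(i, j) (2^-1 * partial i (partial j (fun v => F x v ^+ 2)) y).

Definition spray (i : 'I_n) (x y : 'rV[R]_n) : R :=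
  4^-1 * \sum_j invmx (fundamental_tensor x y) i j *
    (\sum_r partial j (fun v => partial r (fun u => F u v ^+ 2) x) y * y 0 r
     - partial j (fun u => F u y ^+ 2) x).

End LocalFinsler.

Definition douglas_type (R : realType) (n : nat) (G : manifoldType R n)
    (F : finsler R n G) : Prop :=
  forall c : chart R n G, atlas c ->
  exists (Gamma : 'I_n -> 'I_n -> 'I_n -> 'rV[R]_n -> R)
         (P : 'rV[R]_n -> 'rV[R]_n -> R),
    (forall x y t, chart_codom c x -> y != 0 -> 0 < t ->
       P x (t *: y) = t * P x y) /\
    (forall i x y, chart_codom c x -> y != 0 ->
       spray (F c) i x y =
       2^-1 * (\sum_j \sum_r Gamma i j r x * y 0 j * y 0 r) + P x y * y 0 i).

(* Lebesgue measure of a Borel subset of R^n, by slicing: this is the iterated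
   product of [lebesgue_measure], the product measure of [A] being the
   integral of the measures of its sections. *)
Fixpoint volume (R : realType) (n : nat) : set 'rV[R]_n -> \bar R :=
  match n return set 'rV[R]_n -> \bar R with
  | 0 => fun A => (\1_A (0 : 'rV[R]_0))%:E
  | n'.+1 => fun A =>
      (\int[@lebesgue_measure R]_t
         volume [set y : 'rV[R]_n' | A (row_mx (t%:M : 'rV[R]_1) y)])%E
  end.

Definition bh_density (R : realType) (n : nat) (N : 'rV[R]_n -> R) : R :=
  fine (volume [set y : 'rV[R]_n | \sum_i y 0 i ^+ 2 < 1]) /
  fine (volume [set y : 'rV[R]_n | N y < 1]).

Definition S_curvature (R : realType) (n : nat)
    (F : 'rV[R]_n -> 'rV[R]_n -> R) (x y : 'rV[R]_n) : R :=
  \sum_r partial r (fun v => spray F r x v) y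
  - \sum_r y 0 r * partial r (fun u => ln (bh_density (F u))) x.

Definition l59_basis (R : realType) (G : lieGroupType R 5) (k l m p q : R)
    (E1 E2 E3 E4 E5 : vfield R 5 G) : Prop :=
  [/\ left_invariant_vector_field E1, left_invariant_vector_field E2,
      left_invariant_vector_field E3, left_invariant_vector_field E4
    & left_invariant_vector_field E5] /\
  [/\ vfield_eq (lie_bracket E1 E2)
        (fun c x => k *: E3 c x + l *: E4 c x + m *: E5 c x),
      vfield_eq (lie_bracket E1 E3) (fun c x => p *: E4 c x)
    & vfield_eq (lie_bracket E2 E3) (fun c x => q *: E5 c x)] /\
  [/\ vfield_eq (lie_bracket E1 E4) (fun _ _ => 0),
      vfield_eq (lie_bracket E1 E5) (fun _ _ => 0),
      vfield_eq (lie_bracket E2 E4) (fun _ _ => 0)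
    & vfield_eq (lie_bracket E2 E5) (fun _ _ => 0)] /\
  [/\ vfield_eq (lie_bracket E3 E4) (fun _ _ => 0),
      vfield_eq (lie_bracket E3 E5) (fun _ _ => 0)
    & vfield_eq (lie_bracket E4 E5) (fun _ _ => 0)].

(* Main.v *)
Require Import Defs.
From mathcomp Require Import all_boot all_order all_algebra.
From mathcomp Require Import all_classical all_reals all_analysis.
From mathcomp Require Import perm measurable_realfun ring lra.

Import Order.TTheory GRing.Theory Num.Theory.
Import numFieldNormedType.Exports.

Local Open Scope classical_set_scope.
Local Open Scope ring_scope.

(** Let [b = a(X, -)] be the one-form dual to [X], let [Gt] be the spray of [a]
    and let [r(y)] be half the Lie derivative of [a] along [X], evaluated on
    [(y, y)]; equivalently [r(y)] is the covariant derivative of [b] in the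
    direction [y], evaluated on [y].

    Since [X] is orthogonal to all brackets of the frame, [b] is closed
    ([oneform_dx_closed]). For a closed [b] the Randers metric has the same
    unparametrised geodesics as [a], and its spray is
    [G = Gt + P y] with [P = r / (2 F)] ([spray_randers], [proj_factorE]).
    As [P] is homogeneous of degree one, Euler's identity gives
    [div_y (P y) = (n + 1) P]. The remaining term [div_y Gt] is
    [1/2 tr(D_y a . a^-1)], which is the derivative of
    [ln (sqrt (det a))] in the direction [y] ([spray_divergence]).

    The Busemann-Hausdorff density of a Randers norm is
    [sqrt ((1 - a(X, X))^(n + 1) det a)] ([bh_density_randers]), because the
    unit ball is an off-centre ellipsoid ([randers_ball]). Since [a(X, X)] is
    constant here, the logarithmic derivative of the density is that of
    [sqrt (det a)] and cancels [div_y Gt]. Hence [S = (n + 1) r / (2 F)], that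
    is [3 r / F] in dimension five ([S_curvature_randers]).

    Finally, let [Y] be extended as a combination of the frame with constant
    coefficients. Then [a(Y, Y)] is constant, and differentiating it along [X]
    turns [r(Y)] into [a([Y, X], Y)] ([half_lie_frame]), which the bracket
    relations evaluate to the stated numerator. *)

(** * Affine changes of variable in one-dimensional integrals *)

Section AffineChange.
Context {R : realType}.
Import HBNNSimple.
Local Notation mu := (@lebesgue_measure R).
Local Notation aff c d := (fun t : R => c * t + d).

Lemma measurable_affine (c d : R) :
  measurable_fun setT
    (aff c d : measurableTypeR R -> measurableTypeR R).
Proof.
apply: continuous_measurable_fun => t.
by apply: cvgD; [apply: cvgMr; exact: cvg_id|exact: cvg_cst].
Qed.

Lemma lebesgue_measure_affine (c : {nonneg R}) (d : R) (A : set R) :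
  0 < c%:num -> measurable A ->
  pushforward (mscale c mu) (aff c%:num d : _ -> measurableTypeR R) A = mu A.
Proof.
move=> c0 mA; apply/esym/lebesgue_measure_unique => //=.
  exact: measurable_affine.
move=> mf _ [[a b] /= ab <-].
rewrite /pushforward/= /mscale/=.
have -> : aff c%:num d @^-1` `]a, b] =
    [set` `](a - d) / c%:num, (b - d) / c%:num]] :> set R.
  apply/seteqP; split => t /=; rewrite !in_itv/= ltr_pdivrMr// ler_pdivlMr//;
    by rewrite ltrBlDr lerBrDr (mulrC t).
rewrite !lebesgue_measure_itv/= !lte_fin ltr_pM2r ?invr_gt0// ltrD2r.
case: ifP => // _; last by rewrite mule0.
by rewrite -!EFinD -EFinM; congr (_%:E); field; lra.
Qed.

(** The integral of a nonnegative function is a supremum over the simple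
    functions below it, which is monotone for arbitrary functions. The lemmas
    of this part all rest on this, so that the volumes of the sections of a set
    can be integrated directly. *)
Lemma le_integral_nneg (f g : R -> \bar R) :
  (forall t, (0 <= f t)%E) -> (forall t, (f t <= g t)%E) ->
  (\int[mu]_t f t <= \int[mu]_t g t)%E.
Proof.
move=> f0 fg; have g0 t : (0 <= g t)%E by apply: le_trans (fg t).
rewrite !ge0_integralTE//; apply: ge_ereal_sup => _ [h /= hf <-].
by apply: ereal_sup_ubound; exists h => //= t; exact: le_trans (fg t).
Qed.

(** Composing a simple function below [f] with the affine map gives a measurable
    function below the composite of [f]. The same bound for the inverse affine
    map yields the equality [integral_affine]. *)
Lemma integral_affine_le (c d : R) (f : R -> \bar R) : 0 < c ->
  (forall t, (0 <= f t)%E) ->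
  (\int[mu]_t f t <= c%:E * \int[mu]_t f (c * t + d)%R)%E.
Proof.
move=> c0 f0.
rewrite [leLHS]ge0_integralTE//; apply: ge_ereal_sup => _ [h /= hf <-].
apply: (@le_trans _ _ (c%:E * \int[mu]_t (h (c * t + d)%R)%:E)%E).
  rewrite -integralT_nnsfun.
  have mh : measurable_fun [set: measurableTypeR R] (EFin \o h).
    exact/measurable_EFinP.
  have := @ge0_integral_pushforward _ _ _ _ _ _ (measurable_affine c d)
    (mscale (NngNum (ltW c0)) mu) setT _ measurableT mh.
  have mha := measurableT_comp mh (measurable_affine c d).
  rewrite preimage_setT (ge0_integral_mscale _ _ _ mha)//; last first.
    by move=> x _; rewrite lee_fin.
  move=> <-; last by move=> x _; rewrite lee_fin.
  rewrite le_eqVlt; apply/orP; left; apply/eqP.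
  apply: eq_measure_integral.
    exact: measurable_affine.
  move=> mf A mA _.
  by apply/esym/(@lebesgue_measure_affine (NngNum (ltW c0))).
apply: lee_wpmul2l; first by rewrite lee_fin ltW.
apply: le_integral_nneg => t //; by rewrite lee_fin.
Qed.

Lemma integral_affine (c d : R) (f : R -> \bar R) : 0 < c ->
  (forall t, (0 <= f t)%E) ->
  (\int[mu]_t f (c * t + d)%R = c^-1%:E * \int[mu]_t f t)%E.
Proof.
move=> c0 f0; apply/eqP; rewrite eq_le; apply/andP; split; last first.
  rewrite -[leRHS]mul1e -(mulVf (lt0r_neq0 c0)) EFinM -muleA.
  apply: lee_wpmul2l; first by rewrite lee_fin invr_ge0 ltW.
  exact: integral_affine_le.
have := @integral_affine_le c^-1 (- (c^-1 * d)) (fun t => f (c * t + d)).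
rewrite invr_gt0 => /(_ c0) /(_ (fun t => f0 _)) /le_trans; apply.
rewrite le_eqVlt; apply/orP; left; apply/eqP; congr (_ * _)%E.
apply: eq_integral => t _; congr f.
by field; rewrite gt_eqF.
Qed.

Lemma integral_scale_le (k : R) (f : R -> \bar R) : 0 < k ->
  (forall t, (0 <= f t)%E) ->
  (k%:E * \int[mu]_t f t <= \int[mu]_t (k%:E * f t))%E.
Proof.
move=> k0 f0; rewrite muleC -lee_pdivlMr//.
rewrite [leLHS]ge0_integralTE//; apply: ge_ereal_sup => _ [h /= hf <-].
rewrite lee_pdivlMr// muleC -integralT_nnsfun -ge0_integralZl_EFin//.
- apply: le_integral_nneg => t; first by rewrite mule_ge0// lee_fin// ltW.
  apply: lee_wpmul2l; [by rewrite lee_fin ltW|exact: hf].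
- by move=> t _; rewrite lee_fin.
- exact/measurable_EFinP.
- exact: ltW.
Qed.

Lemma integral_scale (k : R) (f : R -> \bar R) : 0 < k ->
  (forall t, (0 <= f t)%E) ->
  (\int[mu]_t (k%:E * f t) = k%:E * \int[mu]_t f t)%E.
Proof.
move=> k0 f0; apply/eqP; rewrite eq_le integral_scale_le// andbT.
have := @integral_scale_le k^-1 (fun t => (k%:E * f t)%E).
rewrite invr_gt0 => /(_ k0).
have kf0 t : (0 <= k%:E * f t)%E by rewrite mule_ge0// lee_fin ltW.
have -> : (\int[mu]_t (k^-1%:E * (k%:E * f t)))%E = (\int[mu]_t f t)%E.
  by apply: eq_integral => t _; rewrite muleA -EFinM mulVf ?gt_eqF// mul1e.
move=> /(_ kf0).
move=> /(lee_wpmul2l (x := k%:E)); rewrite muleA -EFinM mulfV ?gt_eqF//.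
by rewrite mul1e lee_fin; apply; exact: ltW.
Qed.

End AffineChange.

(** * Bilinear forms and positive definite matrices *)

Section Bil.
Context {R : realType} {n : nat}.
Implicit Types (A B : 'M[R]_n) (u v w : 'rV[R]_n).

Lemma bilDl A u v w : bil A (u + v) w = bil A u w + bil A v w.
Proof. by rewrite /bil !mulmxDl mxE. Qed.
Lemma bilDr A u v w : bil A w (u + v) = bil A w u + bil A w v.
Proof. by rewrite /bil linearD/= mulmxDr mxE. Qed.
Lemma bilZl A k u v : bil A (k *: u) v = k * bil A u v.
Proof. by rewrite /bil -!scalemxAl mxE. Qed.
Lemma bilZr A k u v : bil A u (k *: v) = k * bil A u v.
Proof. by rewrite /bil linearZ/= -scalemxAr mxE. Qed.
Lemma bilNl A u v : bil A (- u) v = - bil A u v.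
Proof. by rewrite -scaleN1r bilZl mulN1r. Qed.
Lemma bilNr A u v : bil A u (- v) = - bil A u v.
Proof. by rewrite -scaleN1r bilZr mulN1r. Qed.
Lemma bil0l A v : bil A 0 v = 0.
Proof. by rewrite /bil !mul0mx mxE. Qed.
Lemma bil0r A v : bil A v 0 = 0.
Proof. by rewrite /bil trmx0 mulmx0 mxE. Qed.
Lemma bil_suml A (I : finType) (f : I -> 'rV[R]_n) v :
  bil A (\sum_i f i) v = \sum_i bil A (f i) v.
Proof.
apply: (big_morph (fun u => bil A u v)) => [x y|]; [exact: bilDl|exact: bil0l].
Qed.
Lemma bil_sumr A (I : finType) (f : I -> 'rV[R]_n) v :
  bil A v (\sum_i f i) = \sum_i bil A v (f i).
Proof. apply: (big_morph (bil A v)) => [x y|]; [exact: bilDr|exact: bil0r]. Qed.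
Lemma bil_tr A u v : bil A^T u v = bil A v u.
Proof. by rewrite /bil -[in LHS](trmxK u) -!trmx_mul mulmxA mxE. Qed.
Lemma bil_sym A u v : A^T = A -> bil A u v = bil A v u.
Proof. by move=> At; rewrite -{1}At bil_tr. Qed.

Lemma bilMD A B u v : bil (A + B) u v = bil A u v + bil B u v.
Proof. by rewrite /bil mulmxDr mulmxDl mxE. Qed.
Lemma bilMZ k A u v : bil (k *: A) u v = k * bil A u v.
Proof. by rewrite /bil -scalemxAr -scalemxAl mxE. Qed.
Lemma bilM0 u v : bil 0 u v = 0.
Proof. by rewrite /bil mulmx0 mul0mx mxE. Qed.

Lemma bil_delta A i j : bil A (delta_mx 0 i) (delta_mx 0 j) = A i j.
Proof. by rewrite /bil -rowE trmx_delta -colE !mxE. Qed.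

(** Used to recognise a directional derivative in a sum of partial derivatives
    weighted by the components of the direction. *)
Lemma sum_linear (f : 'rV[R]_n -> R) u :
  (forall k v w, f (k *: v + w) = k * f v + f w) ->
  \sum_i u 0 i * f (delta_mx 0 i) = f u.
Proof.
move=> fl; have fD v w : f (v + w) = f v + f w.
  by have := fl 1 v w; rewrite scale1r mul1r.
have f0 : f 0 = 0 by have := fD 0 0; rewrite addr0; lra.
rewrite [in RHS](row_sum_delta u) (big_morph f fD f0); apply: eq_bigr => i _.
by have := fl (u 0 i) (delta_mx 0 i) 0; rewrite !addr0 f0 addr0.
Qed.

Definition pos_def A : Prop := A^T = A /\ forall u, u != 0 -> 0 < bil A u u.

End Bil.

(** * Volumes of boxes, balls and ellipsoids *)

Section Volume.
Context {R : realType}.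
Local Notation mu := (@lebesgue_measure R).

Lemma row_cons0 n (t : R) (y : 'rV[R]_n) :
  (row_mx (t%:M : 'rV[R]_1) y : 'rV[R]_n.+1) 0 ord0 = t.
Proof.
by rewrite !mxE; case: splitP => // j _; rewrite ord1 mxE eqxx mulr1n.
Qed.

Lemma row_consS n (t : R) (y : 'rV[R]_n) (i : 'I_n) :
  (row_mx (t%:M : 'rV[R]_1) y : 'rV[R]_n.+1) 0 (lift ord0 i) = y 0 i.
Proof.
rewrite !mxE; case: splitP => [j|j /eqP]; rewrite lift0 /= ?ord1// eqSS.
by move=> /eqP/ord_inj->.
Qed.

Lemma volume_ge0 n (A : set 'rV[R]_n) : (0 <= volume A)%E.
Proof.
elim: n A => [|n IH] A /=; first by rewrite lee_fin indicE ler0n.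
by apply: integral_ge0 => t _; exact: IH.
Qed.

Lemma le_volume n (A B : set 'rV[R]_n) : A `<=` B -> (volume A <= volume B)%E.
Proof.
elim: n A B => [|n IH] A B AB /=.
  rewrite lee_fin !indicE.
  have [/set_mem/AB/mem_set -> //|_] := boolP (0 \in A).
  exact: ler0n.
apply: le_integral_nneg => t; first exact: volume_ge0.
by apply: IH => y /= /AB.
Qed.

Lemma volume_set0 n : volume (set0 : set 'rV[R]_n) = 0%E.
Proof.
elim: n => [|n IH] /=; first by rewrite indicE in_set0.
rewrite (_ : [set _ | _] = set0) ?IH ?integral0//.
Qed.

Lemma volume_box n (r : R) : 0 < r ->
  volume [set y : 'rV[R]_n | forall i, `|y 0 i| < r] = ((2 * r) ^+ n)%:E.
Proof.
move=> r0; elim: n => [|n IH] /=.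
  by rewrite indicE mem_set// => -[].
transitivity (\int[mu]_t
    (((2 * r) ^+ n)%:E * (\1_(`]- r, r[%classic : set R) t)%:E))%E.
  apply: eq_integral.
  move=> t _; rewrite indicE; have [tr|tr] := boolP (t \in `]- r, r[%classic).
    rewrite mule1 -IH; congr volume; apply/seteqP; split => y /= yr i.
      by have := yr (lift ord0 i); rewrite row_consS.
    have [j ->|->] := unliftP ord0 i; first by rewrite row_consS.
    by rewrite row_cons0 ltr_norml; have := set_mem tr; rewrite /= in_itv.
  rewrite mule0 -(volume_set0 n); congr volume.
  apply/seteqP; split => y //= /(_ ord0).
  rewrite row_cons0 ltr_norml => rt.
  by move/negP: tr; apply; apply/mem_set; rewrite /= in_itv.
rewrite ge0_integralZl_EFin//; last 2 first.
  by apply/measurable_EFinP; exact: measurable_indic.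
  by rewrite exprn_ge0// mulr_ge0// ltW.
rewrite integral_indic// setIT.
have e := @lebesgue_measure_itv R `]- r, r[.
transitivity
  (((2 * r) ^+ n)%:E * lebesgue_measure ([set` `]- r, r[%R] : set R))%E.
  by [].
rewrite e /= lte_fin ifT; last lra.
by rewrite -EFinD -EFinM exprSr; congr (_%:E); ring.
Qed.

(** The ball lies between two boxes. Both bounds matter: they make the real
    number extracted from the volume of the unit ball nonzero, so that it
    cancels in the Busemann-Hausdorff density. *)
Lemma volume_ball_gt0_lty n (rho : R) : (0 < n)%N -> 0 < rho ->
  (0 < volume [set y : 'rV[R]_n | (\sum_i y 0 i ^+ 2 < rho)%R] < +oo)%E.
Proof.
move=> n0 rho0; apply/andP; split.
  (* half the side of a cube inscribed in the ball *)
  pose e := Num.sqrt (rho / n%:R).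
  have e0 : 0 < e by rewrite sqrtr_gt0 divr_gt0// ltr0n.
  have b0 : (0 < (((2 * e) ^+ n)%:E : \bar R))%E.
    by rewrite lte_fin exprn_gt0// mulr_gt0.
  apply: (lt_le_trans b0); rewrite -volume_box//; apply: le_volume => y /= ye.
  have -> : rho = \sum_(i < n) e ^+ 2.
    rewrite sumr_const card_ord sqr_sqrtr ?divr_ge0// 1?ltW//.
    by rewrite -[RHS]mulr_natr divfK// pnatr_eq0 -lt0n.
  apply: ltr_sum.
    by apply/hasP; exists (Ordinal n0) => //; rewrite mem_index_enum.
  by move=> i _; rewrite -ltr_sqrt ?exprn_gt0// !sqrtr_sqr (gtr0_norm e0).
have b0 : ((((2 * Num.sqrt rho) ^+ n)%:E : \bar R) < +oo)%E by rewrite ltry.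
apply: le_lt_trans b0; rewrite -volume_box ?sqrtr_gt0//.
apply: le_volume => y /= ye i.
rewrite -sqrtr_sqr ltr_sqrt//; apply: le_lt_trans ye.
by rewrite (bigD1 i)//= lerDl sumr_ge0// => j _; rewrite sqr_ge0.
Qed.

End Volume.

Section PosDef.
Context {R : realType}.

Lemma pos_def_ge0 {n} (A : 'M[R]_n) u : pos_def A -> 0 <= bil A u u.
Proof.
by move=> [_ Ap]; have [->|/Ap/ltW//] := eqVneq u 0; rewrite bil0l.
Qed.

Lemma pos_def_unit {n} (A : 'M[R]_n) : pos_def A -> A \in unitmx.
Proof.
move=> [_ Ap]; rewrite -row_free_unit; apply: inj_row_free => v vA.
by apply/eqP/negPn/negP => /Ap; rewrite /bil vA mul0mx mxE ltxx.
Qed.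

(** Completing the square in the last [n] variables. *)
Lemma bil_schur {n} (P : 'M[R]_1) (w : 'rV[R]_n) (C : 'M[R]_n) t x :
  C^T = C ->
  bil (block_mx P (w *m C) (C *m w^T) C) (row_mx t%:M x) (row_mx t%:M x) =
  bil C (x + t *: w) (x + t *: w) + t ^+ 2 * (P 0 0 - bil C w w).
Proof.
move=> Ct; rewrite bilDl !bilDr !bilZl !bilZr (bil_sym C x w)//.
have D (M N : 'M[R]_1) : (M + N) 0 0 = M 0 0 + N 0 0 by rewrite mxE.
have Z k (M : 'M[R]_1) : (k *: M) 0 0 = k * M 0 0 by rewrite mxE.
rewrite {1}/bil tr_row_mx mul_row_block mul_row_col tr_scalar_mx.
rewrite !mul_scalar_mx !mul_mx_scalar !mulmxDl -!scalemxAl !mulmxA.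
rewrite D Z D Z D Z -!/(bil _ _ _) (bil_sym C x w)//.
by ring.
Qed.

Lemma det_schur {n} (P : 'M[R]_1) (w : 'rV[R]_n) (C : 'M[R]_n) :
  \det (block_mx P (w *m C) (C *m w^T) C) = (P 0 0 - bil C w w) * \det C.
Proof.
have -> : block_mx P (w *m C) (C *m w^T) C =
    block_mx 1%:M w 0 1%:M *m block_mx (P - w *m C *m w^T) 0 (C *m w^T) C.
  by rewrite mulmx_block !mul1mx !mul0mx ?mulmx0 !add0r mulmxA subrK.
by rewrite det_mulmx det_ublock det_lblock !det1 !mul1r det_mx11 2!mxE.
Qed.

(** The induction slices the ellipsoid by its first coordinate. In each slice
    the square is completed, which turns the slice into a translate of a lower
    dimensional ellipsoid; the remaining integral over the first coordinate is
    an affine change of variable. *)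
Lemma volume_ellipsoid n (Q : 'M[R]_n) z rho : pos_def Q ->
  0 < \det Q /\
  volume [set y | bil Q (y - z) (y - z) < rho] =
  ((Num.sqrt (\det Q))^-1%:E *
   volume [set y : 'rV[R]_n | (\sum_i y 0 i ^+ 2 < rho)%R])%E.
Proof.
elim: n Q z rho => [|n IH] Q z rho [Qt Qp].
  rewrite det_mx00 sqrtr1 invr1 mul1e; split=> //=; congr (\1_ _ _)%:E.
  by apply/seteqP; split => y /=; rewrite big_ord0 [y - z]thinmx0 bil0l.
move: Q z Qt Qp; rewrite -[n.+1]/(1 + n)%N => Q z Qt Qp.
pose P : 'M[R]_1 := ulsubmx Q; pose C : 'M[R]_n := drsubmx Q.
(* [w] shifts the slice at height [t] by [- t w], and [s], the Schur
   complement, is what remains in front of [t ^+ 2]. *)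
pose w : 'rV[R]_n := ursubmx Q *m invmx C.
have Ct : C^T = C by rewrite /C trmx_drsub Qt.
have Cp : pos_def C.
  split=> // u u0; have := Qp (row_mx 0 u).
  rewrite -[Q]submxK -/C /bil tr_row_mx mul_row_block mul_row_col trmx0 mulmx0.
  rewrite !mul0mx !add0r; apply; apply: contra u0 => /eqP u0.
  by rewrite -(row_mxKr (0 : 'rV[R]_1) u) u0 linear0.
have Cu := pos_def_unit C Cp.
have QE : Q = block_mx P (w *m C) (C *m w^T) C.
  rewrite -[LHS]submxK -/P -/C mulmxKV//; congr block_mx.
  by rewrite trmx_mul trmx_inv Ct mulKVmx// trmx_ursub Qt.
pose s := P 0 0 - bil C w w.
have s0 : 0 < s.
  have := Qp (row_mx 1%:M (- w)); rewrite QE bil_schur// scale1r addNr bil0l.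
  rewrite expr1n mul1r add0r; apply; apply/eqP => /(congr1 lsubmx).
  rewrite row_mxKl linear0 => /matrixP/(_ 0 0); rewrite !mxE => /eqP.
  by rewrite oner_eq0.
have [dC0 _] := IH C 0 0 Cp.
rewrite QE det_schur -/s; split; first exact: mulr_gt0.
pose c := Num.sqrt s; have c0 : 0 < c by rewrite sqrtr_gt0.
pose z0 := lsubmx z 0 0; pose z1 := rsubmx z.
pose f t := volume [set y : 'rV[R]_n | (\sum_i y 0 i ^+ 2 < rho - t ^+ 2)%R].
have f0 t : (0 <= f t)%E by exact: volume_ge0.
transitivity (\int[@lebesgue_measure R]_t
    ((Num.sqrt (\det C))^-1%:E * f (c * t + (- (c * z0)))%R))%E.
  apply: eq_integral => t _.
  rewrite /f -(IH C (z1 - ((t : R) - z0) *: w) _ Cp).2//; congr volume.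
  have e y : row_mx t%:M y - z = row_mx (t - z0)%:M (y - z1).
    rewrite -[X in _ - X = _]hsubmxK opp_row_mx add_row_mx -/z1.
    by rewrite [lsubmx z]mx11_scalar -/z0 -raddfB.
  have e2 : (c * t + - (c * z0)) ^+ 2 = (t - z0) ^+ 2 * s.
    by rewrite -mulrBr exprMn sqr_sqrtr 1?ltW// mulrC.
  apply/seteqP; split => y /=; rewrite e bil_schur// -/s e2 ltrBrDr opprB addrA.
    by rewrite addrAC.
  by rewrite addrAC.
rewrite integral_scale ?invr_gt0 ?sqrtr_gt0//.
rewrite integral_affine// muleA -EFinM; congr (_ * _)%E.
  by rewrite -invfM (sqrtrM _ (ltW s0)) [in RHS]mulrC.
apply: eq_integral => t _; congr volume; apply/seteqP.
have e (y : 'rV[R]_n) :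
    \sum_i (row_mx (t%:M : 'rV[R]_1) y : 'rV[R]_n.+1) 0 i ^+ 2 =
    t ^+ 2 + \sum_i y 0 i ^+ 2.
  rewrite big_ord_recl row_cons0; congr (_ + _).
  by apply: eq_bigr => i _; rewrite row_consS.
by split => y /=; rewrite e ltrBrDl.
Qed.

Lemma pos_def_det_gt0 {n} (A : 'M[R]_n) : pos_def A -> 0 < \det A.
Proof. by move=> Ap; exact: (volume_ellipsoid n A 0 1 Ap).1. Qed.

End PosDef.

(** * The Busemann-Hausdorff density of a Randers norm *)

Section RandersVolume.
Context {R : realType} {n : nat}.
Implicit Types (A : 'M[R]_n) (X : 'rV[R]_n).

(** Both sides are determinants of the block matrix with blocks [1], [X A],
    [A X^T] and [A], eliminated in the two possible orders. *)
Lemma det_rank1 A X : A^T = A ->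
  \det (A - (X *m A)^T *m (X *m A)) = (1 - bil A X X) * \det A.
Proof.
move=> At; have AX : A *m X^T = (X *m A)^T by rewrite trmx_mul At.
have := det_schur 1%:M X A; rewrite mxE eqxx => <-.
have -> : block_mx 1%:M (X *m A) (A *m X^T) A =
    block_mx 1%:M 0 (A *m X^T) 1%:M *m
    block_mx 1%:M (X *m A) 0 (A - A *m X^T *m (X *m A)).
  by rewrite mulmx_block !mul1mx !mulmx1 !mul0mx ?mulmx0 !addr0 subrKC.
by rewrite det_mulmx det_lblock det_ublock !det1 !mul1r AX.
Qed.

Lemma bil_rank1 A X u v : A^T = A ->
  bil (A - (X *m A)^T *m (X *m A)) u v = bil A u v - bil A X u * bil A X v.
Proof.
move=> At.
rewrite /bil mulmxBr mulmxBl [in LHS]mxE; congr (_ + _).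
rewrite [in LHS]mxE; congr (- _).
set p := X *m A; rewrite mulmxA -mulmxA [u *m _]mx11_scalar.
rewrite mul_scalar_mx mxE; congr (_ * _).
by rewrite -[u in LHS]trmxK -trmx_mul mxE.
Qed.

(** Cauchy-Schwarz in disguise: with [b = <X, u>] one has
    [<u, u> - b ^+ 2 = |u - b X| ^+ 2 + b ^+ 2 (1 - <X, X>)]. *)
Lemma pos_def_rank1 A X : pos_def A -> bil A X X < 1 ->
  pos_def (A - (X *m A)^T *m (X *m A)).
Proof.
move=> Ap X1; have At := Ap.1; split.
  by rewrite linearB/= trmx_mul trmxK At.
move=> u u0; rewrite bil_rank1//.
pose b := bil A X u.
have -> : bil A u u - b * b =
    bil A (u - b *: X) (u - b *: X) + b ^+ 2 * (1 - bil A X X).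
  rewrite bilDl !bilDr !bilNl !bilNr !bilZl !bilZr (bil_sym A u X)// -/b; ring.
have X1' : 0 < 1 - bil A X X by rewrite subr_gt0.
have [b0|b0] := eqVneq b 0.
  by rewrite b0 scale0r subr0 expr0n mul0r addr0; exact: Ap.2.
by rewrite ltr_wpDl ?pos_def_ge0// mulr_gt0// exprn_even_gt0.
Qed.

(** Square [|y| < 1 - <X, y>] and complete the square. The factor [d] in [Q]
    normalises the right-hand side of the inequality to [1]. *)
Lemma randers_ball A X (d := 1 - bil A X X)
    (Q := d *: (A - (X *m A)^T *m (X *m A))) (z := - d^-1 *: X) :
  pos_def A -> bil A X X < 1 ->
  [set y | Num.sqrt (bil A y y) + bil A X y < 1] =
  [set y | bil Q (y - z) (y - z) < 1].
Proof.
move=> Ap X1; have At := Ap.1.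
have d0 : 0 < d by rewrite subr_gt0.
have key y : bil Q (y - z) (y - z) =
    d * (bil A y y - bil A X y ^+ 2 + 2 * bil A X y) + (1 - d).
  rewrite /Q /z bilMZ bil_rank1// bilDl !bilDr !bilNl !bilNr !bilZl !bilZr.
  rewrite (bil_sym A y X)// (_ : bil A X X = 1 - d); last by rewrite /d; ring.
  by field; rewrite gt_eqF.
have q y : (bil Q (y - z) (y - z) < 1) = (bil A y y < (1 - bil A X y) ^+ 2).
  rewrite key -subr_gt0 -[RHS]subr_gt0 -[RHS](pmulr_rgt0 _ d0).
  by congr (0 < _); ring.
suff e y : (Num.sqrt (bil A y y) + bil A X y < 1) =
    (bil A y y < (1 - bil A X y) ^+ 2).
  by apply/seteqP; split => y /=; rewrite q e.
have y0 : 0 <= bil A y y by exact: pos_def_ge0.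
have cauchy_schwarz : bil A X y ^+ 2 <= bil A y y.
  have [->|yn] := eqVneq y 0; first by rewrite !bil0r expr0n.
  have := (pos_def_rank1 A X Ap X1).2 y yn.
  by rewrite bil_rank1// subr_gt0 => /ltW.
rewrite -ltrBrDr.
have [b1|b1] := ltP (bil A X y) 1.
  have b1' : 0 < 1 - bil A X y by rewrite subr_gt0.
  by rewrite -[X in _ < X](gtr0_norm b1') -sqrtr_sqr ltr_sqrt// exprn_gt0.
(* When [1 <= bil A X y] both sides fail: squaring creates no new solution,
   because [bil A y y < (bil A X y - 1) ^+ 2 < bil A X y ^+ 2] contradicts
   Cauchy-Schwarz. *)
apply/idP/idP => H.
  by have := le_lt_trans (sqrtr_ge0 _) H; rewrite subr_gt0 ltNge b1.
have := le_lt_trans cauchy_schwarz H; rewrite sqrrB expr1n mul1r => h.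
have : bil A X y *+ 2 < 1 by lra.
by move: b1; lra.
Qed.

Lemma bh_density_randers A X : (0 < n)%N -> pos_def A -> bil A X X < 1 ->
  bh_density (fun y => Num.sqrt (bil A y y) + bil A X y) =
  Num.sqrt ((1 - bil A X X) ^+ n.+1 * \det A).
Proof.
move=> n0 Ap X1; pose d := 1 - bil A X X; have d0 : 0 < d by rewrite subr_gt0.
pose Q := d *: (A - (X *m A)^T *m (X *m A)).
have Qp : pos_def Q.
  have [Qt Qp] := pos_def_rank1 A X Ap X1; split; first by rewrite linearZ/= Qt.
  by move=> u u0; rewrite bilMZ mulr_gt0//; exact: Qp.
rewrite /bh_density randers_ball// -/d -/Q.
have [dQ ->] := volume_ellipsoid n Q (- d^-1 *: X) 1 Qp.
have /andP[v0 voo] := @volume_ball_gt0_lty R n 1 n0 ltr01.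
rewrite fineM//; last by rewrite ge0_fin_numE// ltW.
rewrite /= invfM invrK mulrCA divff ?mulr1; last first.
  by rewrite gt_eqF// fine_gt0// v0 voo.
by rewrite /Q detZ det_rank1; [rewrite exprSr mulrA|exact: Ap.1].
Qed.

End RandersVolume.

(** * Rules for directional derivatives *)

Section Derivatives.
Context {R : realType} {V : normedModType R}.
Implicit Types (x h : V).

Lemma is_derive_diff {W : normedModType R} (f : V -> W) x h :
  differentiable f x -> is_derive x h f ('d f x h).
Proof. by move=> fd; rewrite -deriveE//; apply/derivableP/diff_derivable. Qed.

Lemma is_derive_unique {W : normedModType R} (f : V -> W) x h d1 d2 :
  is_derive x h f d1 -> is_derive x h f d2 -> d1 = d2.
Proof. by move=> [_ <-] [_ <-]. Qed.

(** Reduces a directional derivative to a function of one real variable, for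
    which a chain rule and the derivatives of [Num.sqrt] and [ln] are known. *)
Lemma is_derive_line {W : normedModType R} (f : V -> W) x h df :
  is_derive x h f df <-> is_derive (0 : R) 1 (fun t : R => f (t *: h + x)) df.
Proof.
have E : 'D_h f x = 'D_1 (fun t : R => f (t *: h + x)) 0.
  rewrite /derive; set a := fun t => _; set b := fun t => _.
  suff -> : a = b by [].
  by apply/funext => t; rewrite /a /b /= scale0r add0r addr0 [t *: 1]mulr1.
split=> -[d e].
  by constructor; [exact: (derivable1P _ _ _).1|rewrite -E].
by constructor; [exact: (derivable1P _ _ _).2|rewrite E].
Qed.

Lemma is_derive_comp_fun (f : V -> R) (g : R -> R) x h (df dg : R) :
  is_derive (f x) 1 g dg -> is_derive x h f df ->
  is_derive x h (g \o f) (dg * df).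
Proof.
move=> gd /is_derive_line fd; apply/is_derive_line.
have := @is_derive1_comp _ g (fun t : R => f (t *: h + x)) 0 dg df.
by rewrite scale0r add0r => /(_ gd fd).
Qed.

(** The difference quotient is constant. *)
Lemma is_derive_linear {W : normedModType R} (f : {linear V -> W}) x h :
  is_derive x h f (f h).
Proof.
have e : (fun t : R => t^-1 *: (f (t *: h + x) - f x)) @ 0^' --> f h.
  apply: cvg_near_cst; near=> t.
  have t0 : t != 0 by near: t; exact: nbhs_dnbhs_neq.
  by rewrite linearP addrK scalerA mulVf// scale1r.
constructor; first by apply/cvg_ex; exists (f h).
by rewrite /derive; exact: cvg_lim e.
Unshelve. all: by end_near. Qed.

Lemma is_derive_coord {m n} (f : V -> 'M[R]_(m, n)) x h df i j :
  is_derive x h f df -> is_derive x h (fun u => f u i j) (df i j).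
Proof.
move=> [fd <-]; rewrite derive_mx// mxE; constructor => //.
exact: (derivable_mxP _ _ _).1 fd i j.
Qed.

Lemma is_derive_mx {m n} (f : V -> 'M[R]_(m, n)) x h (df : 'M[R]_(m, n)) :
  (forall i j, is_derive x h (fun u => f u i j) (df i j)) -> is_derive x h f df.
Proof.
move=> d; have fd : derivable f x h.
  by apply/derivable_mxP => i j; have [] := d i j.
constructor => //; rewrite derive_mx//; apply/matrixP => i j.
by rewrite mxE; have [] := d i j.
Qed.

Lemma is_derive_plus {W : normedModType R} (f g : V -> W) x h df dg :
  is_derive x h f df -> is_derive x h g dg ->
  is_derive x h (fun u => f u + g u) (df + dg).
Proof. by move=> fd gd; exact: is_deriveD. Qed.

Lemma is_derive_mul (f g : V -> R) x h df dg :
  is_derive x h f df -> is_derive x h g dg ->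
  is_derive x h (fun u => f u * g u) (df * g x + f x * dg).
Proof.
move=> fd gd; apply: (is_derive_eq (is_deriveM fd gd)).
by rewrite addrC [_ *: df]mulrC.
Qed.

Lemma is_derive_inv (f : V -> R) x h df : f x != 0 ->
  is_derive x h f df -> is_derive x h (fun u => (f u)^-1) (- df / f x ^+ 2).
Proof.
move=> f0 [fd <-]; have := deriveV f0 fd; rewrite /GRing.scale/= => e.
apply: (is_derive_eq (derivableP (derivableV f0 fd))).
by rewrite [LHS]e !mulNr mulrC.
Qed.

Lemma is_derive_sqr (f : V -> R) x h df :
  is_derive x h f df -> is_derive x h (fun u => f u ^+ 2) (2 * f x * df).
Proof.
move=> fd; under eq_fun do rewrite expr2.
by apply: is_derive_eq (is_derive_mul _ _ _ _ _ _ fd fd) _; ring.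
Qed.

Lemma is_derive_bigsum (I : Type) (r : seq I) (P : pred I) (f : I -> V -> R)
    x h (df : I -> R) :
  (forall i, is_derive x h (f i) (df i)) ->
  is_derive x h (fun u => \sum_(i <- r | P i) f i u) (\sum_(i <- r | P i) df i).
Proof.
move=> d; elim: r => [|i r IH].
  under eq_fun do rewrite big_nil.
  by rewrite big_nil; exact: is_derive_cst.
under eq_fun do rewrite big_cons.
by rewrite big_cons; case: ifP => _ //; exact: is_derive_plus.
Qed.

Lemma is_derive_mulmx {m n p} (f : V -> 'M[R]_(m, n)) (g : V -> 'M[R]_(n, p))
    x h df dg :
  is_derive x h f df -> is_derive x h g dg ->
  is_derive x h (fun u => f u *m g u) (df *m g x + f x *m dg).
Proof.
move=> fd gd; apply: is_derive_mx => i j.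
under eq_fun do rewrite mxE.
rewrite !mxE -big_split /=; apply: is_derive_bigsum => k.
have fk := is_derive_coord _ _ _ _ i k fd.
have gk := is_derive_coord _ _ _ _ k j gd.
exact: is_derive_mul.
Qed.

Lemma is_derive_tr {m n} (f : V -> 'M[R]_(m, n)) x h df :
  is_derive x h f df -> is_derive x h (fun u => (f u)^T) df^T.
Proof.
move=> fd; apply: is_derive_mx => i j; under eq_fun do rewrite mxE.
by rewrite mxE; exact: is_derive_coord.
Qed.

Lemma is_derive_bil {n} (A : V -> 'M[R]_n) (f g : V -> 'rV[R]_n) x h dA df dg :
  is_derive x h A dA -> is_derive x h f df -> is_derive x h g dg ->
  is_derive x h (fun u => bil (A u) (f u) (g u))
    (bil dA (f x) (g x) + bil (A x) df (g x) + bil (A x) (f x) dg).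
Proof.
move=> Ad fd gd.
have := is_derive_coord _ _ _ _ 0 0
  (is_derive_mulmx _ _ _ _ _ _ (is_derive_mulmx _ _ _ _ _ _ fd Ad)
     (is_derive_tr _ _ _ _ gd)).
by rewrite mulmxDl 2!mxE (addrC (_ 0 0)).
Qed.

Lemma is_derive_prod (I : eqType) (r : seq I) (f : I -> V -> R) x h
    (df : I -> R) :
  uniq r -> (forall i, is_derive x h (f i) (df i)) ->
  is_derive x h (fun u => \prod_(i <- r) f i u)
    (\sum_(i <- r) \prod_(j <- r) (if j == i then df i else f j x)).
Proof.
move=> + d; elim: r => [_|i r IH /= /andP[ir ur]].
  under eq_fun do rewrite big_nil.
  by rewrite big_nil; exact: is_derive_cst.
under eq_fun do rewrite big_cons.
apply: is_derive_eq (is_derive_mul _ _ _ _ _ _ (d i) (IH ur)) _.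
rewrite !big_cons eqxx; congr (_ * _ + _).
  by apply: eq_big_seq => j jr; case: eqP => // ji; rewrite -ji jr in ir.
rewrite mulr_sumr; apply: eq_big_seq => j jr; rewrite big_cons ifF//.
by apply/eqP => ij; rewrite ij jr in ir.
Qed.

(** Jacobi's formula: the Leibniz expansion is differentiated factor by factor,
    and the determinant with row [k] differentiated is expanded along that
    row. *)
Lemma is_derive_det {n} (A : V -> 'M[R]_n) x h dA :
  is_derive x h A dA ->
  is_derive x h (fun u => \det (A u)) (\tr (dA *m \adj (A x))).
Proof.
move=> Ad; pose B k := \matrix_(i, j) (if i == k then dA i j else A x i j).
have -> : \tr (dA *m \adj (A x)) = \sum_k \det (B k).
  apply: eq_bigr => k _; rewrite (expand_det_row _ k) !mxE.
  apply: eq_bigr => j _; rewrite !mxE eqxx; congr (_ * (_ * \det _)).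
  apply/matrixP => a b; rewrite !mxE ifF//.
  by apply/negbTE; rewrite eq_sym neq_lift.
rewrite /determinant exchange_big /=; apply: is_derive_bigsum => s.
rewrite -mulr_sumr.
apply: is_derive_eq; first apply: (is_derive_mul (fun=> (-1) ^+ s)).
  apply: is_derive_prod; first exact: index_enum_uniq.
  by move=> i; exact: (is_derive_coord _ _ _ _ i (s i) Ad).
rewrite mul0r add0r; congr (_ * _).
apply: eq_bigr => k _; apply: eq_bigr => j _.
by rewrite mxE; case: eqP => // ->.
Qed.

End Derivatives.

Section DeriveBil.
Context {R : realType} {n : nat}.
Implicit Types (B : 'M[R]_n) (v w x : 'rV[R]_n).

Lemma is_derive_bilv B v w : B^T = B ->
  is_derive v w (fun v => bil B v v) (2 * bil B v w).
Proof.
move=> Bt; apply: is_derive_eq.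
  apply: (is_derive_bil (fun=> B) id id);
    exact: is_derive_cst || exact: is_derive_id.
by rewrite bilM0 add0r (bil_sym B w v)//; ring.
Qed.

Lemma is_derive_bilr B x v w : is_derive v w (bil B x) (bil B x w).
Proof.
apply: is_derive_eq.
  apply: (is_derive_bil (fun=> B) (fun=> x) id);
    exact: is_derive_cst || exact: is_derive_id.
by rewrite bilM0 bil0l !add0r.
Qed.

Lemma is_derive_bill B x v w : is_derive v w (bil B ^~ x) (bil B w x).
Proof.
apply: is_derive_eq.
  apply: (is_derive_bil (fun=> B) id (fun=> x));
    exact: is_derive_cst || exact: is_derive_id.
by rewrite bilM0 bil0r addr0 add0r.
Qed.

Lemma near_neq0 (y : 'rV[R]_n) : y != 0 -> \forall v \near y, v != 0.
Proof. by move=> y0; exact: (@cvgr_neq0 _ _ _ (nbhs y) _ id y) y0. Qed.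

End DeriveBil.

(** * The spray of a Randers metric with closed one-form *)

(** Only the values and the first derivatives of the fields at one base point
    enter the spray over that point, so everything is expressed by the metric
    [A], the vector [X] and the linear maps [DA] and [DX], which are the
    differentials of the two fields. *)
Section RandersPoint.
Context {R : realType} {n : nat}.
Variables (A : 'M[R]_n) (X : 'rV[R]_n).
Variables (DA : {linear 'rV[R]_n -> 'M[R]_n}).
Variables (DX : {linear 'rV[R]_n -> 'rV[R]_n}).
Hypotheses (Ap : pos_def A) (X1 : bil A X X < 1).
Hypothesis DAt : forall h, (DA h)^T = DA h.
Implicit Types (u v w y h : 'rV[R]_n).

Let At : A^T = A := Ap.1.

Definition riem_norm v := Num.sqrt (bil A v v).
Definition randers_norm v := riem_norm v + bil A X v.
(** Suffix [_dy]: derivative along the fibre; suffix [_dx]: derivative in the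
    base point. *)
Definition randers_dy v w := bil A v w / riem_norm v + bil A X w.
Definition randers_dydy v w w' := bil A w w' / riem_norm v
  - bil A v w * bil A v w' / riem_norm v ^+ 3.
(** Derivative, in the base direction [h], of the one-form dual to [X]. Its
    symmetry in [h] and [w] says that the one-form is closed at the point. *)
Definition oneform_dx h w := bil (DA h) X w + bil A (DX h) w.
Definition randers_dx v h :=
  bil (DA h) v v / (2 * riem_norm v) + oneform_dx h v.
Definition randers_dxdy v h w := bil (DA h) v w / riem_norm v
  - bil (DA h) v v * bil A v w / (2 * riem_norm v ^+ 3) + oneform_dx h w.

Lemma riem_norm_gt0 v : v != 0 -> 0 < riem_norm v.
Proof. by move=> v0; rewrite sqrtr_gt0; exact: Ap.2. Qed.

Lemma riem_norm_sqr v : riem_norm v ^+ 2 = bil A v v.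
Proof. by rewrite sqr_sqrtr// pos_def_ge0. Qed.

(** The product of [|v| + <X, v>] and [|v| - <X, v>] is positive by
    [pos_def_rank1], and so is their sum. *)
Lemma randers_norm_gt0 v : v != 0 -> 0 < randers_norm v.
Proof.
move=> v0; have v1 := riem_norm_gt0 v v0.
have := (pos_def_rank1 A X Ap X1).2 v v0; rewrite bil_rank1//.
rewrite -riem_norm_sqr /randers_norm -expr2 subr_sqr => h.
have [//|b0] := ltP 0 (riem_norm v + bil A X v).
have : 0 <= riem_norm v - bil A X v by lra.
by move=> /mulr_ge0_le0 /(_ b0); rewrite leNgt h.
Qed.

Lemma is_derive_riem_norm v w : v != 0 ->
  is_derive v w riem_norm (bil A v w / riem_norm v).
Proof.
move=> v0; apply: is_derive_eq.
  apply: (is_derive_comp_fun (fun v => bil A v v) Num.sqrt); last first.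
    exact: is_derive_bilv.
  by apply: is_derive1_sqrt; exact: Ap.2.
by rewrite -/(riem_norm v); field; rewrite gt_eqF// riem_norm_gt0.
Qed.

Lemma is_derive_randers_norm v w : v != 0 ->
  is_derive v w randers_norm (randers_dy v w).
Proof.
move=> v0; apply: is_derive_plus; last exact: is_derive_bilr.
exact: is_derive_riem_norm.
Qed.

Lemma is_derive_randers_dy v w' w : v != 0 ->
  is_derive v w (randers_dy ^~ w') (randers_dydy v w w').
Proof.
move=> v0; have n0 : riem_norm v != 0 by rewrite gt_eqF// riem_norm_gt0.
apply: is_derive_eq.
  apply: is_derive_plus.
    apply: is_derive_mul; first exact: is_derive_bill.
    apply: is_derive_inv => //; exact: is_derive_riem_norm.
by rewrite /randers_dydy; field.
Qed.

Lemma is_derive_randers_dx v h w : v != 0 ->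
  is_derive v w (randers_dx ^~ h) (randers_dxdy v h w).
Proof.
move=> v0; have n0 : riem_norm v != 0 by rewrite gt_eqF// riem_norm_gt0.
apply: is_derive_eq.
  apply: is_derive_plus.
    apply: is_derive_mul; first exact: is_derive_bilv.
    apply: is_derive_inv; first by rewrite mulf_neq0// pnatr_eq0.
    by apply: is_derive_mul; exact: is_derive_riem_norm.
  by apply: is_derive_plus; exact: is_derive_bilr.
by rewrite /randers_dxdy /oneform_dx; field.
Qed.

(** The fundamental tensor [g = F F_yy + F_y F_y] as a bilinear form, see
    [fundamental_tensorE]. *)
Definition fund_form y w w' :=
  randers_norm y * randers_dydy y w w' + randers_dy y w * randers_dy y w'.

Lemma fund_form_linear y w k u v :
  fund_form y w (k *: u + v) = k * fund_form y w u + fund_form y w v.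
Proof.
by rewrite /fund_form /randers_dydy /randers_dy !bilDr !bilZr; ring.
Qed.

Lemma fund_formC y w w' : fund_form y w w' = fund_form y w' w.
Proof. by rewrite /fund_form /randers_dydy (bil_sym A w w')//; ring. Qed.

(** If [v] is in the kernel, pairing with [y] kills the radial part of [v]: by
    homogeneity [F_yy y = 0] and [F_y y = F], so [F_y v = 0]. Then [F_yy v = 0]
    makes [v] a multiple of [y], and [F_y v = 0] makes this multiple zero. *)
Lemma fund_form_nondeg y v : y != 0 -> (forall w, fund_form y v w = 0) -> v = 0.
Proof.
move=> y0 vg; have F0 := randers_norm_gt0 y y0; have n0 := riem_norm_gt0 y y0.
have n2 := riem_norm_sqr y.
have v1 : randers_dy y v = 0.
  have := vg y; rewrite /fund_form.
  have -> : randers_dydy y v y = 0.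
    by rewrite /randers_dydy -n2 (bil_sym A v y)//; field; rewrite gt_eqF.
  have -> : randers_dy y y = randers_norm y.
    by rewrite /randers_dy -n2 /randers_norm; field; rewrite gt_eqF.
  by rewrite mulr0 add0r => /eqP; rewrite mulf_eq0 (gt_eqF F0) orbF => /eqP.
pose t := bil A y v / riem_norm y ^+ 2.
have vt : v - t *: y = 0.
  apply/eqP/negPn/negP => /Ap.2; rewrite [X in 0 < X](_ : _ = 0) ?ltxx//.
  rewrite bilDl bilNl bilZl.
  have := vg (v - t *: y); rewrite /fund_form v1 mul0r addr0 => /eqP.
  rewrite mulf_eq0 (gt_eqF F0)/= => /eqP; rewrite /randers_dydy => h.
  have -> : bil A v (v - t *: y) - t * bil A y (v - t *: y) = riem_norm y *
    (bil A v (v - t *: y) / riem_norm y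
     - bil A y v * bil A y (v - t *: y) / riem_norm y ^+ 3).
    by rewrite /t; field; rewrite gt_eqF.
  by rewrite h mulr0.
have vE : v = t *: y by apply/eqP; rewrite -subr_eq0 vt.
move: v1; rewrite vE /randers_dy !bilZr -n2 => h.
have /eqP : t * randers_norm y = 0.
  by rewrite -h /randers_norm; field; rewrite gt_eqF.
by rewrite mulf_eq0 (gt_eqF F0) orbF => /eqP ->; rewrite scale0r.
Qed.

(** The spray of the Riemannian metric itself, characterised by
    [bil_riem_spray]. *)
Definition riem_spray y : 'rV[R]_n :=
  (\row_j (4^-1 * (2 * bil (DA y) y (delta_mx 0 j)
                   - bil (DA (delta_mx 0 j)) y y)))
  *m invmx A.

Lemma bil_riem_spray y w :
  bil A (riem_spray y) w = 4^-1 * (2 * bil (DA y) y w - bil (DA w) y y).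
Proof.
rewrite /bil /riem_spray mulmxKV ?pos_def_unit//.
rewrite -/(bil _ _ _) -/(bil _ _ _) mxE.
rewrite -(sum_linear
  (fun w => 4^-1 * (2 * bil (DA y) y w - bil (DA w) y y))).
  by apply: eq_bigr => j _; rewrite !mxE mulrC.
by move=> k u v; rewrite linearP bilMD bilMZ bilDr bilZr; ring.
Qed.

(** The numerator is the covariant derivative of the one-form, hence
    [proj_factorE]. *)
Definition proj_factor y :=
  (oneform_dx y y - 2 * bil A X (riem_spray y)) / (2 * randers_norm y).

Hypothesis closed : forall u v, oneform_dx u v = oneform_dx v u.

(** The equation that defines the spray, tested against [w]. Closedness turns
    the antisymmetrised derivative of the Randers norm into that of the
    Riemannian norm, which [bil_riem_spray] controls; the component along [y]
    determines [proj_factor]. *)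
Lemma fund_form_spray y w : y != 0 ->
  4 * fund_form y w (riem_spray y + proj_factor y *: y) =
  2 * randers_dy y w * randers_dx y y
  + 2 * randers_norm y * randers_dxdy y y w
  - 2 * randers_norm y * randers_dx y w.
Proof.
move=> y0; have F0 := randers_norm_gt0 y y0; have n0 := riem_norm_gt0 y y0.
have n2 := riem_norm_sqr y.
rewrite fund_formC /fund_form /randers_dydy /randers_dy /randers_dx.
rewrite /randers_dxdy !bilDl !bilDr !bilZl !bilZr.
rewrite (bil_sym A y (riem_spray y))// !bil_riem_spray -!n2 (closed y w).
rewrite /proj_factor; move: F0; rewrite /randers_norm => F0.
by field; rewrite !gt_eqF.
Qed.

Section Local.
Variables (F : 'rV[R]_n -> 'rV[R]_n -> R) (x : 'rV[R]_n).
Hypothesis Fx : forall v, F x v = randers_norm v.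
Hypothesis dF : forall v h, v != 0 ->
  is_derive x h (fun u => F u v ^+ 2) (2 * randers_norm v * randers_dx v h).

Lemma fundamental_tensorE y i j : y != 0 ->
  fundamental_tensor F x y i j = fund_form y (delta_mx 0 i) (delta_mx 0 j).
Proof.
move=> y0; rewrite mxE.
have -> : (fun v => F x v ^+ 2) = (fun v => randers_norm v ^+ 2).
  by apply/funext => v; rewrite Fx.
have d2 : is_derive y (delta_mx 0 i)
    (partial j (fun v => randers_norm v ^+ 2))
    (2 * fund_form y (delta_mx 0 i) (delta_mx 0 j)).
  apply: near_eq_is_derive (_ : is_derive _ _
      (fun v => 2 * randers_norm v * randers_dy v (delta_mx 0 j)) _).
    near=> v; have v0 : v != 0 by near: v; exact: near_neq0.
    have d1 := is_derive_sqr _ _ _ _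
      (is_derive_randers_norm v (delta_mx 0 j) v0).
    by rewrite /partial derive_val.
  apply: is_derive_eq.
    apply: is_derive_mul; last exact: is_derive_randers_dy.
    by apply: is_derive_mul; exact: is_derive_randers_norm.
  by rewrite /fund_form; ring.
by rewrite {1}/partial derive_val mulrA mulVf ?mul1r// pnatr_eq0.
Unshelve. all: by end_near. Qed.

(** The fundamental matrix is invertible by [fund_form_nondeg], so the spray is
    the only solution of its defining equation, and [fund_form_spray] provides
    one. *)
Lemma spray_randers i y : y != 0 ->
  spray F i x y = (riem_spray y + proj_factor y *: y) 0 i.
Proof.
move=> y0; pose G := riem_spray y + proj_factor y *: y.
pose M := fundamental_tensor F x y.
have ME : M *m G^T = \col_j fund_form y (delta_mx 0 j) G.
  apply/colP => j; rewrite !mxE -(sum_linear (fund_form y (delta_mx 0 j))).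
    by apply: eq_bigr => k _; rewrite fundamental_tensorE// mxE mulrC.
  exact: fund_form_linear.
have Mu : M \in unitmx.
  rewrite -row_free_unit; apply: inj_row_free => v vM.
  apply: (fund_form_nondeg y) => // w.
  rewrite -(sum_linear (fund_form y v)); last exact: fund_form_linear.
  rewrite big1// => j _.
  rewrite fund_formC -(sum_linear (fund_form y (delta_mx 0 j))).
    have /matrixP/(_ 0 j) := vM; rewrite !mxE => vMj.
    rewrite [X in _ * X](_ : _ = 0) ?mulr0// -[RHS]vMj; apply: eq_bigr => k _.
    by rewrite fundamental_tensorE// fund_formC.
  exact: fund_form_linear.
transitivity ((invmx M *m (M *m G^T)) i 0); last by rewrite mulKmx// mxE.
rewrite /spray ME mxE mulr_sumr; apply: eq_bigr => j _.
rewrite -/M mxE mulrCA; congr (_ * _).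
rewrite -[RHS](mulKf (_ : 4 != 0)) ?pnatr_eq0//; congr (_ * _).
rewrite fund_form_spray//; congr (_ - _).
  pose f h := 2 * randers_dy y (delta_mx 0 j) * randers_dx y h
    + 2 * randers_norm y * randers_dxdy y h (delta_mx 0 j).
  rewrite -[RHS]/(f y) -(sum_linear f); last first.
    move=> k u v; rewrite /f /randers_dx /randers_dxdy /oneform_dx !linearP.
    by rewrite !bilMD !bilMZ !bilDl !bilZl; ring.
  apply: eq_bigr => r _; rewrite mulrC; congr (_ * _).
  apply: derive_val.
  apply: near_eq_is_derive (_ : is_derive _ _
      (fun v => 2 * randers_norm v * randers_dx v (delta_mx 0 r)) _).
    near=> v; have v0 : v != 0 by near: v; exact: near_neq0.
    by have := dF v (delta_mx 0 r) v0 => d1; rewrite /partial derive_val.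
  apply: is_derive_eq.
    apply: is_derive_mul; last exact: is_derive_randers_dx.
    by apply: is_derive_mul; exact: is_derive_randers_norm.
  by rewrite /f /=; ring.
by have d1 := dF y (delta_mx 0 j) y0; rewrite /partial derive_val.
Unshelve. all: by end_near. Qed.

Definition riem_spray_dy y w : 'rV[R]_n :=
  (\row_j (2^-1 * (bil (DA w) y (delta_mx 0 j) + bil (DA y) w (delta_mx 0 j)
                   - bil (DA (delta_mx 0 j)) y w))) *m invmx A.

Lemma is_derive_bilDA y w u : is_derive y w (fun v => bil (DA v) v u)
  (bil (DA w) y u + bil (DA y) w u).
Proof.
apply: is_derive_eq.
  apply: (is_derive_bil DA id (fun=> u)); exact: is_derive_linear.
by rewrite bil0r addr0.
Qed.

Lemma is_derive_riem_spray y w : is_derive y w riem_spray (riem_spray_dy y w).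
Proof.
apply: is_derive_eq.
  apply: (is_derive_mulmx _ (fun=> invmx A)).
  apply: (is_derive_mx _ _ _ (\row_j (2^-1 * (bil (DA w) y (delta_mx 0 j)
     + bil (DA y) w (delta_mx 0 j) - bil (DA (delta_mx 0 j)) y w)))) => i j.
  under eq_fun do rewrite mxE.
  apply: is_derive_eq.
    apply: (is_derive_mul (fun=> 4^-1)).
    apply: is_derive_plus; last first.
      apply: is_deriveN; exact: is_derive_bilv.
    apply: (is_derive_mul (fun=> 2)); exact: is_derive_bilDA.
  by rewrite mxE; field.
by rewrite mulmx0 addr0.
Qed.

(** Of the three terms of the Christoffel symbol only one survives: the other
    two are contracted antisymmetrically with the symmetric matrix [invmx A]. *)
Lemma riem_spray_divergence y :
  \sum_i riem_spray_dy y (delta_mx 0 i) 0 i = 2^-1 * \tr (DA y *m invmx A).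
Proof.
pose B := invmx A; have Bt i j : B i j = B j i.
  by rewrite /B -[X in invmx X i j]At -trmx_inv mxE.
pose S i j := bil (DA (delta_mx 0 i)) y (delta_mx 0 j).
transitivity (\sum_i \sum_j (2^-1 * (DA y i j * B j i)
   + 2^-1 * (S i j * B j i) - 2^-1 * (S j i * B j i))).
  apply: eq_bigr => i _; rewrite /riem_spray_dy mxE; apply: eq_bigr => j _.
  by rewrite mxE bil_delta -/(S i j) -/(S j i) -/B; ring.
under eq_bigr do rewrite sumrB big_split/=.
rewrite sumrB big_split/= [X in _ + X - _]exchange_big/=.
have -> : \sum_i \sum_j 2^-1 * (S j i * B j i) =
    \sum_j \sum_i 2^-1 * (S i j * B j i).
  by apply: eq_bigr => i _; apply: eq_bigr => j _; rewrite Bt.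
rewrite addrK /mxtrace mulr_sumr; apply: eq_bigr => i _.
by rewrite mxE mulr_sumr.
Qed.

(** Half the Lie derivative of the metric along [X], evaluated on [(y, y)]; it
    equals the covariant derivative of the one-form in the direction [y],
    evaluated on [y]. *)
Definition half_lie y := bil A (DX y) y + 2^-1 * bil (DA X) y y.
Definition half_lie_dy y w :=
  bil A (DX w) y + bil A (DX y) w + bil (DA X) y w.

Lemma proj_factorE y : proj_factor y = half_lie y / (2 * randers_norm y).
Proof.
rewrite /proj_factor (bil_sym A X)// bil_riem_spray /oneform_dx /half_lie.
by rewrite (bil_sym (DA y) X)//; congr (_ / _); field.
Qed.

Lemma is_derive_half_lie y w : is_derive y w half_lie (half_lie_dy y w).
Proof.
apply: is_derive_eq.
  apply: is_derive_plus.
    apply: (is_derive_bil (fun=> A) DX id); exact: is_derive_linear.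
  apply: (is_derive_mul (fun=> 2^-1)); exact: is_derive_bilv.
by rewrite /half_lie_dy bilM0/=; field.
Qed.

Definition proj_factor_dy y w :=
  half_lie_dy y w / (2 * randers_norm y)
  - half_lie y * randers_dy y w / (2 * randers_norm y ^+ 2).

Lemma is_derive_proj_factor y w : y != 0 ->
  is_derive y w proj_factor (proj_factor_dy y w).
Proof.
move=> y0; have F0 := randers_norm_gt0 y y0.
have -> : proj_factor = fun y => half_lie y / (2 * randers_norm y).
  by apply/funext => v; exact: proj_factorE.
apply: is_derive_eq.
  apply: is_derive_mul; first exact: is_derive_half_lie.
  apply: is_derive_inv; first by rewrite mulf_neq0// ?pnatr_eq0// gt_eqF.
  by apply: (is_derive_mul (fun=> 2)); exact: is_derive_randers_norm.
by rewrite /proj_factor_dy/=; field; rewrite gt_eqF.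
Qed.

(** Euler's identity for [proj_factor], which is homogeneous of degree one. *)
Lemma proj_factor_euler y : y != 0 ->
  \sum_i y 0 i * proj_factor_dy y (delta_mx 0 i) = proj_factor y.
Proof.
move=> y0; have F0 := randers_norm_gt0 y y0; have n0 := riem_norm_gt0 y y0.
rewrite sum_linear; last first.
  move=> k u v; rewrite /proj_factor_dy /half_lie_dy /randers_dy linearP.
  rewrite !bilDr !bilZr !bilDl !bilZl.
  by field; rewrite !gt_eqF.
have -> : proj_factor_dy y y =
    half_lie_dy y y / (2 * randers_norm y) - half_lie y / (2 * randers_norm y).
  rewrite /proj_factor_dy (_ : randers_dy y y = randers_norm y).
    by field; rewrite gt_eqF.
  by rewrite /randers_dy -riem_norm_sqr /randers_norm; field; rewrite gt_eqF.
have -> : half_lie_dy y y = 2 * half_lie y.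
  by rewrite /half_lie_dy /half_lie; field.
by rewrite proj_factorE; field; rewrite gt_eqF.
Qed.

(** The coefficient [n.+1] is [n] from the trace of the identity plus [1] from
    Euler's identity. *)
Lemma spray_divergence y : y != 0 ->
  \sum_i partial i (fun v => spray F i x v) y =
  2^-1 * \tr (DA y *m invmx A) + n.+1%:R * proj_factor y.
Proof.
move=> y0.
have d i : partial i (fun v => spray F i x v) y =
    riem_spray_dy y (delta_mx 0 i) 0 i
    + (y 0 i * proj_factor_dy y (delta_mx 0 i) + proj_factor y).
  apply: derive_val.
  apply: near_eq_is_derive (_ : is_derive _ _
      (fun v => riem_spray v 0 i + proj_factor v * v 0 i) _).
    near=> v; have v0 : v != 0 by near: v; exact: near_neq0.
    by rewrite spray_randers// !mxE.
  apply: is_derive_eq.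
    apply: is_derive_plus.
      by apply: is_derive_coord; exact: is_derive_riem_spray.
    apply: is_derive_mul; first exact: is_derive_proj_factor.
    exact: (is_derive_coord id).
  have -> : (delta_mx 0 i : 'rV[R]_n) 0 i = 1 by rewrite mxE !eqxx.
  by rewrite /=; ring.
under eq_bigr do rewrite d.
rewrite !big_split/= riem_spray_divergence proj_factor_euler//.
rewrite sumr_const card_ord.
by rewrite -[_ *+ n]mulr_natl -natr1; ring.
Unshelve. all: by end_near. Qed.

End Local.

End RandersPoint.

(** * The S-curvature for a closed one-form of constant length *)

Section RandersField.
Context {R : realType} {n : nat}.
Variables (a : 'rV[R]_n -> 'M[R]_n) (xi : 'rV[R]_n -> 'rV[R]_n) (x : 'rV[R]_n).
Hypotheses (ad : differentiable a x) (xid : differentiable xi x).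
Hypothesis a_pos : \forall u \near x, pos_def (a u).
Variable N : R.
Hypothesis xiN : \forall u \near x, bil (a u) (xi u) (xi u) = N.
Hypothesis N1 : N < 1.
Let F u v := Num.sqrt (bil (a u) v v) + bil (a u) (xi u) v.

Let Ap : pos_def (a x).
Proof. exact: nbhs_singleton a_pos. Qed.

Let X1 : bil (a x) (xi x) (xi x) < 1.
Proof. by rewrite (nbhs_singleton xiN). Qed.

Lemma diff_metric_sym h : ('d a x h)^T = 'd a x h.
Proof.
have d1 := is_derive_tr _ _ _ _ (is_derive_diff a x h ad).
have d2 : is_derive x h a ('d a x h)^T.
  apply: near_eq_is_derive d1; near=> u.
  have : pos_def (a u) by near: u; exact: a_pos.
  by case.
exact: (is_derive_unique _ _ _ _ _ d2 (is_derive_diff a x h ad)).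
Unshelve. all: by end_near. Qed.

Lemma is_derive_randers_sqr v h : v != 0 ->
  is_derive x h (fun u => F u v ^+ 2)
   (2 * randers_norm (a x) (xi x) v *
    randers_dx (a x) (xi x) ('d a x) ('d xi x) v h).
Proof.
move=> v0; apply: is_derive_sqr.
apply: is_derive_eq.
  apply: is_derive_plus.
    apply: (is_derive_comp_fun (fun u => bil (a u) v v) Num.sqrt).
      by apply: is_derive1_sqrt; exact: Ap.2.
    apply: (is_derive_bil a (fun=> v) (fun=> v)); exact: is_derive_diff.
  apply: (is_derive_bil a xi (fun=> v)); exact: is_derive_diff.
rewrite !bil0r !bil0l !addr0 /randers_dx /oneform_dx /riem_norm; congr (_ + _).
by rewrite mulrC.
Qed.

(** The density is [sqrt (K det a)] with [K] constant; Jacobi's formula gives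
    its logarithmic derivative. *)
Lemma is_derive_ln_bh_density h : (0 < n)%N ->
  is_derive x h (fun u => ln (bh_density (F u)))
    (2^-1 * \tr ('d a x h *m invmx (a x))).
Proof.
move=> n0; have Au := pos_def_unit _ Ap; have d0 := pos_def_det_gt0 _ Ap.
pose K := (1 - N) ^+ n.+1; have K0 : 0 < K by rewrite exprn_gt0// subr_gt0.
have Kd0 : 0 < K * \det (a x) by exact: mulr_gt0.
apply: near_eq_is_derive (_ : is_derive _ _
    (fun u => ln (Num.sqrt (K * \det (a u)))) _).
  near=> u; have up : pos_def (a u) by near: u; exact: a_pos.
  have uN : bil (a u) (xi u) (xi u) = N by near: u; exact: xiN.
  by rewrite /F bh_density_randers// uN.
apply: is_derive_eq.
  apply: (is_derive_comp_fun (fun u => Num.sqrt (K * \det (a u))) (@ln R)).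
    by apply: is_derive1_ln; rewrite sqrtr_gt0.
  apply: (is_derive_comp_fun (fun u => K * \det (a u)) Num.sqrt).
    exact: is_derive1_sqrt.
  apply: (is_derive_mul (fun=> K)); apply: is_derive_det; exact: is_derive_diff.
rewrite mul0r add0r /invmx Au -scalemxAr linearZ/=.
have s0 : Num.sqrt (K * \det (a x)) ^+ 2 = K * \det (a x).
  by rewrite sqr_sqrtr// ltW.
have sn : Num.sqrt (K * \det (a x)) != 0 by rewrite gt_eqF// sqrtr_gt0.
set s := Num.sqrt _ in s0 sn *; set t := \tr _; set d := \det _ in d0 s0 *.
have -> : s^-1 * ((2 * s)^-1 * (K * t)) = K * t / (2 * s ^+ 2) by field.
by rewrite s0; field; rewrite !gt_eqF.
Unshelve. all: by end_near. Qed.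

(** The divergence of the Riemannian spray cancels the logarithmic derivative of
    the density, and only the projective factor remains. *)
Lemma S_curvature_randers y : (0 < n)%N -> y != 0 ->
  (forall u v, oneform_dx (a x) (xi x) ('d a x) ('d xi x) u v =
               oneform_dx (a x) (xi x) ('d a x) ('d xi x) v u) ->
  S_curvature F x y = n.+1%:R *
    (half_lie (a x) (xi x) ('d a x) ('d xi x) y / (2 * F x y)).
Proof.
move=> n0 y0 closed.
rewrite /S_curvature.
rewrite (spray_divergence (a x) (xi x) ('d a x) ('d xi x) Ap X1
  diff_metric_sym closed F x
  (fun=> erefl) is_derive_randers_sqr y y0).
rewrite (proj_factorE _ _ _ _ Ap diff_metric_sym) -/(F x y).
have -> : \sum_r y 0 r * partial r (fun u => ln (bh_density (F u))) x =
    2^-1 * \tr ('d a x y *m invmx (a x)).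
  rewrite -(sum_linear (fun h => 2^-1 * \tr ('d a x h *m invmx (a x)))).
    apply: eq_bigr => r _; congr (_ * _).
    have d := is_derive_ln_bh_density (delta_mx 0 r) n0.
    by rewrite /partial derive_val.
  by move=> k u v; rewrite linearP mulmxDl -scalemxAl linearP /=; ring.
by rewrite addrAC subrr add0r.
Qed.

End RandersField.

(** * Orthonormal frames *)

(** In this section [xi] has constant coefficients in the frame [e], as a left
    invariant field has in a left invariant frame. *)
Section Frame.
Context {R : realType} {n : nat}.
Variables (a : 'rV[R]_n -> 'M[R]_n) (xi : 'rV[R]_n -> 'rV[R]_n) (x : 'rV[R]_n).
Variables (e : 'I_n -> 'rV[R]_n -> 'rV[R]_n) (c : 'I_n -> R).
Hypotheses (ad : differentiable a x) (xid : differentiable xi x).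
Hypothesis ed : forall i, differentiable (e i) x.
Hypothesis a_pos : \forall u \near x, pos_def (a u).
Hypothesis e_orth : \forall u \near x, forall i j,
  bil (a u) (e i u) (e j u) = (i == j)%:R.
Hypothesis xiE : \forall u \near x, xi u = \sum_i c i *: e i u.

Definition frame_bracket i j := 'd (e j) x (e i x) - 'd (e i) x (e j x).

Let orth i j : bil (a x) (e i x) (e j x) = (i == j)%:R.
Proof. exact: (nbhs_singleton e_orth). Qed.

Let xix : xi x = \sum_i c i *: e i x.
Proof. exact: (nbhs_singleton xiE). Qed.

Let Ap : pos_def (a x).
Proof. exact: nbhs_singleton a_pos. Qed.

(** The matrix of the frame has the left inverse [a E^T], which is also a right
    inverse. *)
Lemma frame_decomp u : u = \sum_i bil (a x) u (e i x) *: e i x.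
Proof.
pose E := \matrix_(i < n) e i x.
have EaE : E *m (a x *m E^T) = 1%:M.
  apply/matrixP => i j; rewrite mulmxA mxE -[RHS]/(1%:M i j) mxE -orth /bil mxE.
  apply: eq_bigr => k _; rewrite !mxE; congr (_ * _).
  by apply: eq_bigr => l _; rewrite !mxE.
rewrite -[LHS]mulmx1 -(mulmx1C EaE) !mulmxA mulmx_sum_row.
apply: eq_bigr => i _; rewrite rowK; congr (_ *: _).
by rewrite /bil !mxE; apply: eq_bigr => k _; rewrite !mxE.
Qed.

Lemma frame_coord (y : 'I_n -> R) k :
  bil (a x) (e k x) (\sum_i y i *: e i x) = y k.
Proof.
rewrite bil_sumr (bigD1 k)//= big1 ?addr0 => [|i ik]; rewrite bilZr orth.
  by rewrite eqxx mulr1.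
by rewrite eq_sym (negbTE ik) mulr0.
Qed.

Lemma diff_frame_sum h : 'd xi x h = \sum_i c i *: 'd (e i) x h.
Proof.
have d1 := is_derive_diff xi x h xid.
have d2 : is_derive x h (\sum_i (fun u => c i *: e i u))
    (\sum_i c i *: 'd (e i) x h).
  by apply: is_derive_sum => i; apply: is_deriveZ; exact: is_derive_diff.
have d3 : is_derive x h xi (\sum_i c i *: 'd (e i) x h).
  apply: near_eq_is_derive d2; near=> u; rewrite fct_sumE.
  by apply/esym; near: u; exact: xiE.
exact: (is_derive_unique _ _ _ _ _ d1 d3).
Unshelve. all: by end_near. Qed.

Let N := \sum_i c i ^+ 2.

Lemma frame_sum_norm : \forall u \near x, bil (a u) (xi u) (xi u) = N.
Proof.
near=> u.
have -> : xi u = \sum_i c i *: e i u by near: u; exact: xiE.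
have o : forall i j, bil (a u) (e i u) (e j u) = (i == j)%:R.
  by near: u; exact: e_orth.
rewrite bil_suml; apply: eq_bigr => i _; rewrite bil_sumr (bigD1 i)//= big1.
  by rewrite bilZl bilZr o eqxx mulr1 addr0.
by move=> j ij; rewrite bilZl bilZr o eq_sym (negbTE ij) !mulr0.
Unshelve. all: by end_near. Qed.

(** Differentiate [a(xi, e i) = c i]. *)
Lemma oneform_dx_frame h i :
  oneform_dx (a x) (xi x) ('d a x) ('d xi x) h (e i x) =
  - bil (a x) (xi x) ('d (e i) x h).
Proof.
apply/eqP; rewrite -subr_eq0 opprK; apply/eqP.
have d1 := is_derive_bil _ _ _ _ _ _ _ _ (is_derive_diff a x h ad)
  (is_derive_diff xi x h xid) (is_derive_diff (e i) x h (ed i)).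
have d2 : is_derive x h (fun u => bil (a u) (xi u) (e i u)) 0.
  apply: near_eq_is_derive (is_derive_cst (c i) x h).
  near=> u.
  have -> : xi u = \sum_i c i *: e i u by near: u; exact: xiE.
  have o : forall i j, bil (a u) (e i u) (e j u) = (i == j)%:R.
    by near: u; exact: e_orth.
  rewrite bil_suml (bigD1 i)//= big1.
    by rewrite bilZl o eqxx mulr1 addr0.
  by move=> j ij; rewrite bilZl o (negbTE ij) mulr0.
exact: (is_derive_unique _ _ _ _ _ d1 d2).
Unshelve. all: by end_near. Qed.

(** The exterior derivative of the one-form on two frame vectors is, up to sign,
    its value on their bracket. *)
Lemma oneform_dx_closed :
  (forall i j, bil (a x) (xi x) (frame_bracket i j) = 0) ->
  forall u v, oneform_dx (a x) (xi x) ('d a x) ('d xi x) u v =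
              oneform_dx (a x) (xi x) ('d a x) ('d xi x) v u.
Proof.
move=> br0 u v; set D := oneform_dx _ _ _ _.
have Dl v' k u1 u2 : D (k *: u1 + u2) v' = k * D u1 v' + D u2 v'.
  by rewrite /D /oneform_dx !linearP bilMD bilMZ bilDl bilZl; ring.
have Dr u' k v1 v2 : D u' (k *: v1 + v2) = k * D u' v1 + D u' v2.
  by rewrite /D /oneform_dx !bilDr !bilZr; ring.
have D0l v' : D 0 v' = 0.
  by have := Dl v' 1 0 0; rewrite scaler0 addr0 mul1r; lra.
have D0r v' : D v' 0 = 0.
  by have := Dr v' 1 0 0; rewrite scaler0 addr0 mul1r; lra.
have Dsl v' (f : 'I_n -> R) (g : 'I_n -> 'rV[R]_n) :
    D (\sum_i f i *: g i) v' = \sum_i f i * D (g i) v'.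
  by elim/big_rec2 : _ => [|i t w _ <-]; [exact: D0l|exact: Dl].
have Dsr v' (f : 'I_n -> R) (g : 'I_n -> 'rV[R]_n) :
    D v' (\sum_i f i *: g i) = \sum_i f i * D v' (g i).
  by elim/big_rec2 : _ => [|i t w _ <-]; [exact: D0r|exact: Dr].
rewrite (frame_decomp u) (frame_decomp v) !Dsl.
under eq_bigr do rewrite Dsr; under [RHS]eq_bigr do rewrite Dsr.
under eq_bigr do rewrite mulr_sumr; under [RHS]eq_bigr do rewrite mulr_sumr.
rewrite [RHS]exchange_big; apply: eq_bigr => i _; apply: eq_bigr => j _.
rewrite mulrCA; congr (_ * (_ * _)); rewrite /D !oneform_dx_frame.
apply/eqP; rewrite -subr_eq0 opprK addrC -bilNr -bilDr; apply/eqP.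
exact: br0.
Qed.

(** The field [Yf] with constant coefficients [y] has constant length; its
    derivative along [xi] expresses the derivative of the metric by that of
    [Yf], and what remains is the bracket of [Yf] and [xi]. *)
Lemma half_lie_frame (y : 'I_n -> R) : let Y := \sum_i y i *: e i x in
  half_lie (a x) (xi x) ('d a x) ('d xi x) Y =
  \sum_i \sum_j y i * c j * bil (a x) (frame_bracket i j) Y.
Proof.
move=> Y; pose X := xi x.
have lie : 2^-1 * bil ('d a x X) Y Y =
    - bil (a x) (\sum_i y i *: 'd (e i) x X) Y.
  pose Yf u := \sum_i y i *: e i u.
  have dY : is_derive x X Yf (\sum_i y i *: 'd (e i) x X).
    have : is_derive x X (\sum_i (fun u => y i *: e i u))
        (\sum_i y i *: 'd (e i) x X).
      by apply: is_derive_sum => i; apply: is_deriveZ; exact: is_derive_diff.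
    by congr is_derive; apply/funext => u; rewrite fct_sumE.
  have d1 := is_derive_bil _ _ _ _ _ _ _ _ (is_derive_diff a x X ad) dY dY.
  have d2 : is_derive x X (fun u => bil (a u) (Yf u) (Yf u)) 0.
    apply: near_eq_is_derive (is_derive_cst (\sum_i y i ^+ 2) x X).
    near=> u.
    have o : forall i j, bil (a u) (e i u) (e j u) = (i == j)%:R.
      by near: u; exact: e_orth.
    rewrite bil_suml; apply: eq_bigr => i _; rewrite bil_sumr (bigD1 i)//= big1.
      by rewrite bilZl bilZr o eqxx mulr1 addr0.
    by move=> j ij; rewrite bilZl bilZr o eq_sym (negbTE ij) !mulr0.
  have := is_derive_unique _ _ _ _ _ d1 d2; rewrite -/Y.
  rewrite (bil_sym (a x) Y)//; last exact: Ap.1.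
  by move=> h; lra.
rewrite /half_lie lie -bilNl -bilDl.
apply: (etrans (congr1 (fun z => bil (a x) (z - _) Y) (diff_frame_sum Y))).
rewrite (eq_bigr (fun i =>
  \sum_j bil (a x) ((y i * c j) *: frame_bracket i j) Y)); last first.
  by move=> i _; apply: eq_bigr => j _; rewrite bilZl.
under eq_bigr do rewrite -bil_suml.
rewrite -bil_suml; congr bil.
have -> : \sum_j c j *: 'd (e j) x Y =
    \sum_i \sum_j (y i * c j) *: 'd (e j) x (e i x).
  rewrite exchange_big; apply: eq_bigr => j _; rewrite linear_sum scaler_sumr.
  by apply: eq_bigr => i _; rewrite linearZ/= scalerA mulrC.
have -> : \sum_i y i *: 'd (e i) x X =
    \sum_i \sum_j (y i * c j) *: 'd (e i) x (e j x).
  apply: eq_bigr => i _; rewrite /X xix linear_sum scaler_sumr.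
  by apply: eq_bigr => j _; rewrite linearZ/= scalerA.
rewrite -sumrB; apply: eq_bigr => i _; rewrite -sumrB; apply: eq_bigr => j _.
by rewrite /frame_bracket scalerBr.
Unshelve. all: by end_near. Qed.

End Frame.

(** * The five-dimensional nilpotent Lie algebra *)

Lemma sum_ord5 (V : nmodType) (f : 'I_5 -> V) : \sum_i f i =
  f (inord 0) + f (inord 1) + f (inord 2) + f (inord 3) + f (inord 4).
Proof.
rewrite !big_ord_recl big_ord0 addr0 !addrA; do !congr (_ + _); congr f;
  by apply: val_inj; rewrite /= inordK.
Qed.

Lemma sum_skew5 (R : comPzRingType) (f : 'I_5 -> 'I_5 -> R) (c y : 'I_5 -> R)
    (i0 := inord 0) (i1 := inord 1) (i2 := inord 2) (i3 := inord 3)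
    (i4 := inord 4) :
  (forall i j, f i j = - f j i) -> (forall i, f i i = 0) ->
  c i2 = 0 -> c i3 = 0 -> c i4 = 0 ->
  \sum_i \sum_j y i * c j * f i j =
    (y i0 * c i1 - y i1 * c i0) * f i0 i1
    - y i2 * (c i0 * f i0 i2 + c i1 * f i1 i2)
    - y i3 * (c i0 * f i0 i3 + c i1 * f i1 i3)
    - y i4 * (c i0 * f i0 i4 + c i1 * f i1 i4).
Proof.
move=> fC fii c2 c3 c4.
under eq_bigr do rewrite sum_ord5 c2 c3 c4.
rewrite sum_ord5 !fii (fC i1 i0) (fC i2 i0) (fC i3 i0) (fC i4 i0) (fC i2 i1).
by rewrite (fC i3 i1) (fC i4 i1); ring.
Qed.

Theorem theorem3p16 (R : realType) (G : lieGroupType R 5)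
    (k l m p q : R) (a : bilfield R 5 G) (E1 E2 E3 E4 E5 X : vfield R 5 G)
    (lambda1 lambda2 : R)
    (G_simply_connected : simply_connected R G)
    (G_nilpotent : nilpotent_group G)
    (a_left_invariant : left_invariant_metric a)
    (E_basis : l59_basis k l m p q E1 E2 E3 E4 E5)
    (E_orthonormal : orthonormal_frame a (tnth [tuple E1; E2; E3; E4; E5]))
    (parameters :
       [/\ 0 < k, 0 < p < q, 0 <= l & 0 <= m] \/
       [/\ 0 < k, 0 < p, 0 <= l, m = 0 & q = p])
    (X_left_invariant : left_invariant_vector_field X)
    (X_def : vfield_eq X (fun c x => lambda1 *: E1 c x + lambda2 *: E2 c x))
    (X_norm : norm_lt1 a X)
    (F_left_invariant : left_invariant_finsler (randers a X))
    (F_non_riemannian : ~ riemannian_finsler (randers a X))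
    (F_douglas : douglas_type (randers a X))
    (c : chart R 5 G) (c_atlas : atlas c) (c_at_e : chart_dom c 1%g)
    (y1 y2 y3 y4 y5 : R) :
  let F := randers a X c in
  let e := c 1%g in
  let Y := y1 *: E1 c e + y2 *: E2 c e + y3 *: E3 c e + y4 *: E4 c e
           + y5 *: E5 c e in
  Y != 0 ->
  S_curvature F e Y =
  3 * (((y1 * lambda2 - y2 * lambda1) * (k * y3 + l * y4 + m * y5)
        - y3 * (p * lambda1 * y4 + q * lambda2 * y5)) / F e Y).
Proof.
move=> F e Y Y0.
have e_in : chart_codom c e by exists 1%g.
have U_near : \forall u \near e, chart_codom c u.
  by apply: open_nbhs_nbhs; split => //; exact: chart_codom_open.
have smooth_diff (W : normedModType R) (f : 'rV[R]_5 -> W) :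
    smooth_on (chart_codom c) f -> differentiable f e.
  by move=> /(_ 1%N)[fd _]; exact: fd.
have diffE (Z : vfield R 5 G) :
    left_invariant_vector_field Z -> differentiable (Z c) e.
  by move=> [[Zs _] _]; exact: smooth_diff (Zs c c_atlas).
have [[as_ ap _] _] := a_left_invariant.
have ad : differentiable (a c) e by exact: smooth_diff (as_ c c_atlas).
pose frame := tnth [tuple E1; E2; E3; E4; E5].
pose coef := tnth [tuple lambda1; lambda2; 0; 0; 0].
pose yy := tnth [tuple y1; y2; y3; y4; y5].
have [[l1 l2 l3 l4 l5] [[b12 b13 b23] brackets0]] := E_basis.
have [[b14 b15 b24 b25] [b34 b35 b45]] := brackets0.
have ed (i : 'I_5) : differentiable (frame i c) e.
  by apply: diffE; case: i => [[|[|[|[|[|]]]]]] //= ?;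
    rewrite /frame (tnth_nth E1).
have a_pos : \forall u \near e, pos_def (a c u).
  by apply: filterS U_near => u Uu; have [] := ap c c_atlas u Uu.
have e_orth : \forall u \near e, forall i j,
    bil (a c u) (frame i c u) (frame j c u) = (i == j)%:R.
  by apply: filterS U_near => u Uu; exact: E_orthonormal.
have xiE : \forall u \near e, X c u = \sum_i coef i *: frame i c u.
  apply: filterS U_near => u Uu; rewrite X_def// sum_ord5.
  rewrite /coef /frame !(tnth_nth E1) !(tnth_nth 0) !inordK//=.
  by rewrite !scale0r !addr0.
pose fr i := frame i c.
have ap_e : pos_def (a c e) by exact: nbhs_singleton a_pos.
pose br := frame_bracket e fr.
have brE i j : br i j = lie_bracket (frame i) (frame j) c e.
  by rewrite /br /frame_bracket /lie_bracket !deriveE.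
have brC i j : br i j = - br j i by rewrite /br /frame_bracket opprB.
have fE i (hi : (i < 5)%N) :
    frame (inord i) = nth E1 [:: E1; E2; E3; E4; E5] i.
  by rewrite /frame (tnth_nth E1) inordK.
have cE i (hi : (i < 5)%N) :
    coef (inord i) = nth 0 [:: lambda1; lambda2; 0; 0; 0] i.
  by rewrite /coef (tnth_nth 0) inordK.
have yE i (hi : (i < 5)%N) : yy (inord i) = nth 0 [:: y1; y2; y3; y4; y5] i.
  by rewrite /yy (tnth_nth 0) inordK.
have YE : Y = \sum_i yy i *: fr i e.
  by rewrite sum_ord5 /fr !fE// !yE.
have prX i : bil (a c e) (fr i e) (X c e) = coef i.
  by rewrite (nbhs_singleton xiE) (frame_coord _ _ _ e_orth).
have prY i : bil (a c e) (fr i e) Y = yy i.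
  by rewrite YE (frame_coord _ _ _ e_orth).
have B01 : br (inord 0) (inord 1) =
    k *: fr (inord 2) e + l *: fr (inord 3) e + m *: fr (inord 4) e.
  by rewrite brE /fr !fE//= b12.
have B02 : br (inord 0) (inord 2) = p *: fr (inord 3) e.
  by rewrite brE /fr !fE//= b13.
have B12 : br (inord 1) (inord 2) = q *: fr (inord 4) e.
  by rewrite brE /fr !fE//= b23.
have B03 : br (inord 0) (inord 3) = 0 by rewrite brE !fE//= b14.
have B04 : br (inord 0) (inord 4) = 0 by rewrite brE !fE//= b15.
have B13 : br (inord 1) (inord 3) = 0 by rewrite brE !fE//= b24.
have B14 : br (inord 1) (inord 4) = 0 by rewrite brE !fE//= b25.
have B23 : br (inord 2) (inord 3) = 0 by rewrite brE !fE//= b34.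
have B24 : br (inord 2) (inord 4) = 0 by rewrite brE !fE//= b35.
have B34 : br (inord 3) (inord 4) = 0 by rewrite brE !fE//= b45.
have Bii i : br i i = 0 by rewrite /br /frame_bracket subrr.
(* All brackets are combinations of [E3], [E4] and [E5], and [X] is orthogonal
   to these. *)
have closed i j : bil (a c e) (X c e) (br i j) = 0.
  rewrite (bil_sym _ _ _ ap_e.1).
  have lt (i' j' : 'I_5) :
      (i' < j')%N -> bil (a c e) (br i' j') (X c e) = 0.
    move=> ij; rewrite -[i']inord_val -[j']inord_val; move: ij.
    case: i' => [[|[|[|[|[|]]]]]] //= _; case: j' => [[|[|[|[|[|]]]]]] //= _ _.
    - by rewrite B01 !bilDl !bilZl !prX !cE//= !mulr0 !addr0.
    - by rewrite B02 bilZl prX cE//= mulr0.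
    - by rewrite B03 bil0l.
    - by rewrite B04 bil0l.
    - by rewrite B12 bilZl prX cE//= mulr0.
    - by rewrite B13 bil0l.
    - by rewrite B14 bil0l.
    - by rewrite B23 bil0l.
    - by rewrite B24 bil0l.
    - by rewrite B34 bil0l.
  case: (ltngtP i j) => [/lt//|/lt h|/val_inj->].
    by rewrite brC bilNl h oppr0.
  by rewrite Bii bil0l.
have N1 : \sum_i coef i ^+ 2 < 1.
  have Xn := nbhs_singleton (frame_sum_norm (a c) (X c) e fr coef e_orth xiE).
  have := X_norm c c_atlas e e_in; rewrite Xn => s1.
  have N0 : 0 <= \sum_i coef i ^+ 2 by apply: sumr_ge0 => i _; exact: sqr_ge0.
  by rewrite -(sqr_sqrtr N0) -[1](expr1n _ 2) ltrXn2r// ?nnegrE ?sqrtr_ge0.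
have Xd : differentiable (X c) e by exact: diffE.
have dc := oneform_dx_closed (a c) (X c) e fr coef ad Xd ed e_orth xiE closed.
rewrite /F (S_curvature_randers (a c) (X c) e ad Xd a_pos _
  (frame_sum_norm (a c) (X c) e fr coef e_orth xiE) N1 Y isT Y0 dc).
have -> : half_lie (a c e) (X c e) ('d (a c) e) ('d (X c) e) Y =
    (y1 * lambda2 - y2 * lambda1) * (k * y3 + l * y4 + m * y5)
        - y3 * (p * lambda1 * y4 + q * lambda2 * y5).
  rewrite [in LHS]YE.
  rewrite (half_lie_frame (a c) (X c) e fr coef ad Xd ed a_pos e_orth xiE) -YE.
  rewrite -/br.
  have skew i j :
      bil (a c e) (br i j) Y = - bil (a c e) (br j i) Y.
    by rewrite brC bilNl.
  have diag i : bil (a c e) (br i i) Y = 0 by rewrite Bii bil0l.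
  rewrite (sum_skew5 R (fun i j => bil (a c e) (br i j) Y) coef yy skew diag)
    ?cE// !yE//.
  rewrite B01 B02 B12 B03 B04 B13 B14 !bilDl !bilZl !bil0l !prY !yE//=.
  by ring.
rewrite -/(randers a X c e Y) -/F invfM.
set z := (F e Y)^-1; set num := _ - _.
by field.
Qed.
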